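(* Let $\gamma=(\tilde q,\tilde p)\in\mathcal{D}^{2\alpha}_Z(T^*Q)$ be a solution of the rough Hamilton's equations on $[t_0,t_1]$, and let $\xi^1=(\delta\tilde q^1,\delta\tilde p^1)$ and $\xi^2=(\delta\tilde q^2,\delta\tilde p^2)$ be two solutions of the rough variational equations along $(\tilde q,\tilde p)$. Then $$\omega_{\gamma_t}(\xi^1_t,\xi^2_t)=\omega_{\gamma_s}(\xi^1_s,\xi^2_s)\qquad\text{for all }(s,t)\in[t_0,t_1]^2,$$ where $\omega_{\gamma_{(\cdot)}}$ is the canonical symplectic form evaluated at the point $\gamma_{(\cdot)}\in T^*Q$.
   Context: Let $\alpha\in(\frac13,\frac12]$ and let $\mathbf{Z}=(Z,\mathbb{Z})$ be a fixed geometric $\alpha$-Hölder rough path on $[t_0,t_1]$ with values in $\mathbb{R}^K$ (Chen's relation and $\mathbb{Z}_{s,t}+\mathbb{Z}_{s,t}^*=Z_{s,t}\otimes Z_{s,t}$). $\mathcal{D}^{2\alpha}_Z(W)$ is the space of $W$-valued paths controlled by $Z$: $Y_t-Y_s=Y'_sZ_{s,t}+O(|t-s|^{2\alpha})$ with $Y'$ $\alpha$-Hölder; integrals against $\mathbf{Z}$ are rough integrals, and solutions are controlled paths whose Gubinelli derivatives are the coefficients of $d\mathbf{Z}$. $T^*Q\cong\mathbb{R}^N\times\mathbb{R}^N$; $H\in C^\infty(T^*Q,\mathbb{R})$, $\mathcal{H}=(H_1,\dots,H_K)^T\in C^\infty(T^*Q,\mathbb{R}^K)$, $\mathcal{H}\,d\mathbf{Z}=\sum_jH_j\,d\mathbf{Z}^j$.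 The canonical symplectic form is $\omega=\sum_{i=1}^N\mathrm{d}p_i\wedge\mathrm{d}q^i$. Rough Hamilton's equations (with boundary data $\tilde q_{t_0}=a$, $\tilde p_{t_1}=b$): $$q_t-q_{t_0}=\int_{t_0}^t\Big(\tfrac{\partial H}{\partial p}(q_r,p_r)\,dr+\tfrac{\partial\mathcal{H}}{\partial p}(q_r,p_r)\,d\mathbf{Z}_r\Big),\quad p_{t_1}-p_t=-\int_t^{t_1}\Big(\tfrac{\partial H}{\partial q}(q_r,p_r)\,dr+\tfrac{\partial\mathcal{H}}{\partial q}(q_r,p_r)\,d\mathbf{Z}_r\Big).$$ Rough variational equations for $\xi=(\delta q,\delta p)$, with all second derivatives evaluated at $(\tilde q_r,\tilde p_r)$ and boundary conditions $\delta q_{t_0}=\delta a$, $\delta p_{t_1}=\delta b$ for some $\delta a,\delta b\in\mathbb{R}^N$: $$\delta q_t-\delta q_{t_0}=\int_{t_0}^t\Big(\big[\tfrac{\partial^2H}{\partial p\partial q}\delta q_r+\tfrac{\partial^2H}{\partial p\partial p}\delta p_r\big]dr+\big[\tfrac{\partial^2\mathcal{H}}{\partial p\partial q}\delta q_r+\tfrac{\partial^2\mathcal{H}}{\partial p\partial p}\delta p_r\big]d\mathbf{Z}_r\Big),$$ $$\delta p_{t_1}-\delta p_t=-\int_t^{t_1}\Big(\big[\tfrac{\partial^2H}{\partial q\partial p}\delta p_r+\tfrac{\partial^2H}{\partial q\partial q}\delta q_r\big]dr+\big[\tfrac{\partial^2\mathcal{H}}{\partial q\partial p}\delta p_r+\tfrac{\partial^2\mathcal{H}}{\partial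 q\partial q}\delta q_r\big]d\mathbf{Z}_r\Big).$$ *)

(* Defs.v *)
From HB Require Import structures.
From mathcomp Require Import all_boot all_order all_algebra.
From mathcomp Require Import all_classical all_reals all_analysis.

Set Implicit Arguments.
Unset Strict Implicit.
Unset Printing Implicit Defensive.

Import Order.TTheory GRing.Theory Num.Theory.
Import numFieldNormedType.Exports.

Local Open Scope classical_set_scope.
Local Open Scope ring_scope.

(* For finite-dimensional [V], which is the only case used here, this is the
   usual notion of a function of class C^n. *)
Fixpoint Ck (R : realType) (V W : normedModType R) (n : nat) (f : V -> W) :
    Prop :=
  if n is n'.+1 then
    (forall x, differentiable f x) /\
    (forall v, Ck n' (fun x => 'D_v f x : W))
  else continuous f.

Definition smooth (R : realType) (V W : normedModType R) (f : V -> W) : Prop :=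
  forall n, Ck n f.

Section RoughPaths.
Context {R : realType} {K : nat}.
Variables (alpha t0 t1 : R).

Definition holder (W : normedModType R) (Y : R -> W) : Prop :=
  exists C : R, forall s t, s \in `[t0, t1] -> t \in `[t0, t1] ->
    `|Y t - Y s| <= C * `|t - s| `^ alpha.

Variables (Z : R -> 'cV[R]_K) (ZZ : R -> R -> 'M[R]_K).

(* [ZZ s t j k] stands for the iterated integral of [Z^j_r - Z^j_s] against
   [dZ^k_r] over [s, t]; it is only constrained for [s <= t]. *)
Record geometric_rough_path : Prop := GeometricRoughPath {
  grp_holder : holder Z ;
  grp_holder2 : exists C : R, forall s t, t0 <= s -> s <= t -> t <= t1 ->
    `|ZZ s t| <= C * (t - s) `^ (2 * alpha) ;
  grp_chen : forall s u t, t0 <= s -> s <= u -> u <= t -> t <= t1 ->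
    ZZ s t = ZZ s u + ZZ u t + (Z u - Z s) *m (Z t - Z u)^T ;
  grp_geometric : forall s t, t0 <= s -> s <= t -> t <= t1 ->
    ZZ s t + (ZZ s t)^T = (Z t - Z s) *m (Z t - Z s)^T
}.

(* The Gubinelli derivative, with values in Hom(R^K, W), is represented by its
   components: [Y' j s] is the image of the [j]-th basis vector of R^K. *)
Record controlled (W : normedModType R) (Y : R -> W) (Y' : 'I_K -> R -> W) :
    Prop := Controlled {
  controlled_deriv : forall j, holder (Y' j) ;
  controlled_remainder : exists C : R, forall s t,
    t0 <= s -> s <= t -> t <= t1 ->
    `|Y t - Y s - \sum_j (Z t - Z s) j 0 *: Y' j s|
      <= C * (t - s) `^ (2 * alpha)
}.

(* Compensated Riemann sum of [\sum_k Y_k dZ^k] along the partition [a :: l],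
   where [Y' j k] is the [j]-th component of the Gubinelli derivative of
   [Y k]. *)
Definition compensated_sum (W : normedModType R) (Y : 'I_K -> R -> W)
    (Y' : 'I_K -> 'I_K -> R -> W) (a b : R) (l : seq R) : W :=
  let x := nth b (a :: l) in
  \sum_(0 <= i < size l)
    (\sum_k (Z (x i.+1) - Z (x i)) k 0 *: Y k (x i)
     + \sum_j \sum_k ZZ (x i) (x i.+1) j k *: Y' j k (x i)).

(* [I] is the rough integral of [\sum_k Y_k dZ^k] over [a, b]: the limit of the
   compensated sums as the mesh of the partition tends to 0. *)
Definition is_rough_integral (W : normedModType R) (Y : 'I_K -> R -> W)
    (Y' : 'I_K -> 'I_K -> R -> W) (a b : R) (I : W) : Prop :=
  forall e : R, 0 < e -> exists2 d : R, 0 < d &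
    forall l : seq R, itv_partition a b l ->
      (forall i, (i < size l)%N ->
         nth b (a :: l) i.+1 - nth b (a :: l) i < d) ->
      `|compensated_sum Y Y' a b l - I| < e.

(* Rough integral of [\sum_k F_k(X) dZ^k] for smooth [F_k] and a controlled path
   [(X, X')]; the controlled path [F_k(X)] has Gubinelli derivative
   [DF_k(X) X']. *)
Definition is_rough_integral_comp (V W : normedModType R) (F : 'I_K -> V -> W)
    (X : R -> V) (X' : 'I_K -> R -> V) (a b : R) (I : W) : Prop :=
  is_rough_integral (fun k r => F k (X r))
    (fun j k r => 'D_(X' j r) (F k) (X r)) a b I.

End RoughPaths.

Definition col_integral (R : realType) (d : nat) (f : R -> 'cV[R]_d) (a b : R) :
    'cV[R]_d :=
  \col_i \int[@lebesgue_measure R]_(r in `[a, b]) f r i 0.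

(* T^*Q, with points and tangent vectors written as pairs [(q, p)]. *)
Notation cotangent R N := ('cV[R]_N * 'cV[R]_N)%type.

Section Hamilton.
Context {R : realType} {N : nat}.
Implicit Types (f : cotangent R N -> R) (x : cotangent R N).

Definition basis_q (i : 'I_N) : cotangent R N := (delta_mx i 0, 0).
Definition basis_p (i : 'I_N) : cotangent R N := (0, delta_mx i 0).

Definition grad (e : 'I_N -> cotangent R N) f x : 'cV[R]_N :=
  \col_i 'D_(e i) f x.

Definition hess (e e' : 'I_N -> cotangent R N) f x : 'M[R]_N :=
  \matrix_(i, j) 'D_(e i) (fun y => 'D_(e' j) f y) x.

(* The coefficients of the variational equations, as functions of the base point
   [y.1] in T^*Q and the tangent vector [y.2 = (dq, dp)]. *)
Definition var_q f (y : cotangent R N * cotangent R N) : 'cV[R]_N :=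
  hess basis_p basis_q f y.1 *m y.2.1 + hess basis_p basis_p f y.1 *m y.2.2.

Definition var_p f (y : cotangent R N * cotangent R N) : 'cV[R]_N :=
  hess basis_q basis_p f y.1 *m y.2.2 + hess basis_q basis_q f y.1 *m y.2.1.

(* Differential of a function as a 1-form; [omega] is the sum of the
   [dp_i /\ dq^i]. *)
Definition d1 f : cotangent R N -> cotangent R N -> R := fun x v => 'd f x v.

Definition wedge (a b : cotangent R N -> cotangent R N -> R) x
    (u v : cotangent R N) : R := a x u * b x v - a x v * b x u.

Definition omega x (u v : cotangent R N) : R :=
  \sum_i wedge (d1 (fun y => y.2 i 0)) (d1 (fun y => y.1 i 0)) x u v.
End Hamilton.

Section Solutions.
Context {R : realType} {N K : nat}.
Variables (alpha t0 t1 : R) (Z : R -> 'cV[R]_K) (ZZ : R -> R -> 'M[R]_K).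
Variables (H : cotangent R N -> R) (HH : cotangent R N -> 'cV[R]_K).

Definition comp_HH (k : 'I_K) : cotangent R N -> R := fun x => HH x k 0.

(* Gubinelli derivatives of solutions: the coefficients of [dZ^j]. *)
Definition hamilton_deriv (g : R -> cotangent R N) (j : 'I_K) (r : R) :
    cotangent R N :=
  (grad basis_p (comp_HH j) (g r), - grad basis_q (comp_HH j) (g r)).

Definition variational_deriv (g xi : R -> cotangent R N) (j : 'I_K) (r : R) :
    cotangent R N :=
  (var_q (comp_HH j) (g r, xi r), - var_p (comp_HH j) (g r, xi r)).

Record rough_hamilton_solution (a b : 'cV[R]_N) (g : R -> cotangent R N) :
    Prop := RoughHamiltonSolution {
  rhs_controlled : controlled alpha t0 t1 Z g (hamilton_deriv g) ;
  rhs_bdry_q : (g t0).1 = a ;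
  rhs_bdry_p : (g t1).2 = b ;
  rhs_q : forall t, t \in `[t0, t1] ->
    exists2 I : 'cV[R]_N,
      is_rough_integral_comp Z ZZ (fun k => grad basis_p (comp_HH k))
        g (hamilton_deriv g) t0 t I &
      (g t).1 - (g t0).1
        = col_integral (fun r => grad basis_p H (g r)) t0 t + I ;
  rhs_p : forall t, t \in `[t0, t1] ->
    exists2 I : 'cV[R]_N,
      is_rough_integral_comp Z ZZ (fun k => grad basis_q (comp_HH k))
        g (hamilton_deriv g) t t1 I &
      (g t1).2 - (g t).2
        = - (col_integral (fun r => grad basis_q H (g r)) t t1 + I)
}.

(* The integrands are functions of the joint controlled path [(g, xi)]. *)
Record rough_variational_solution (g : R -> cotangent R N) (da db : 'cV[R]_N)
    (xi : R -> cotangent R N) : Prop := RoughVariationalSolution {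
  rvs_controlled : controlled alpha t0 t1 Z xi (variational_deriv g xi) ;
  rvs_bdry_q : (xi t0).1 = da ;
  rvs_bdry_p : (xi t1).2 = db ;
  rvs_q : forall t, t \in `[t0, t1] ->
    exists2 I : 'cV[R]_N,
      is_rough_integral_comp Z ZZ (fun k => var_q (comp_HH k))
        (fun r => (g r, xi r))
        (fun j r => (hamilton_deriv g j r, variational_deriv g xi j r)) t0 t I &
      (xi t).1 - (xi t0).1
        = col_integral (fun r => var_q H (g r, xi r)) t0 t + I ;
  rvs_p : forall t, t \in `[t0, t1] ->
    exists2 I : 'cV[R]_N,
      is_rough_integral_comp Z ZZ (fun k => var_p (comp_HH k))
        (fun r => (g r, xi r))
        (fun j r => (hamilton_deriv g j r, variational_deriv g xi j r)) t t1 I &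
      (xi t1).2 - (xi t).2
        = - (col_integral (fun r => var_p H (g r, xi r)) t t1 + I)
}.
End Solutions.

(* Main.v *)
Require Import Defs.
From HB Require Import structures.
From mathcomp Require Import all_boot all_order all_algebra.
From mathcomp Require Import all_classical all_reals all_analysis.
From mathcomp Require Import ring lra.
Import Order.TTheory GRing.Theory Num.Theory.
Import numFieldNormedType.Exports.
Local Open Scope classical_set_scope.
Local Open Scope ring_scope.

Set Implicit Arguments.
Unset Strict Implicit.
Unset Printing Implicit Defensive.

(** Along a solution [gamma], each variational solution satisfies a linear
    equation [d xi = L xi dt + sum_k L_k xi dZ^k] whose matrices are Hamiltonian:
    they are the Hessians of [H] and [H_k] multiplied by the symplectic matrix.
    A geometric rough path obeys the ordinary Leibniz rule, so the differential
    of [omega (xi1, xi2)] has the coefficients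
    [omega (L xi1, xi2) + omega (xi1, L xi2)], and these vanish because Hessians
    are symmetric.

    Everything is done with local expansions instead of rough integrals.  A path
    [x] with [dx = b dt + sum_k A_k dZ^k] satisfies
    [x_t - x_s = b_s (t - s) + sum_k Z^k_st A_k(s) + sum_jk ZZ^jk_st A'_jk(s)] up
    to [O((t - s)^(3 alpha))]; this is [rough_expansion].  The integral equations
    give it through three estimates: the sewing bound for Riemann sums over
    dyadic partitions ([dyadic_estimate], [germ_almost_additive]), the drift bound
    ([drift_estimate]), and the fact that smooth functions of controlled paths
    are controlled ([C11_controlled]).  The equation for [q] is posed from [t0],
    that for [p] up to [t1], hence a forward and a backward version.

    Such expansions form an algebra: in the product of two increments the
    second-order term [Z^j Z^k] is [ZZ^jk + ZZ^kj] by geometricity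
    ([rough_expansionM]).  Applied to [omega = sum_i dp_i /\ dq^i], this leaves
    three coefficients.  The one of [dt] and those of [dZ^k] are the invariance
    identity above ([variational_form_eq0]); the second-level ones are
    derivatives of that identity along the equations
    ([variational_form_derivative]), hence vanish as well.  The increments of
    [omega] are therefore [O((t - s)^(3 alpha))] with [3 alpha > 1], and the path
    is constant ([bigO_gt1_constant]).

    Smoothness enters through the class [C11] of functions with locally Lipschitz
    derivative, obtained from bounds on second derivatives over compact balls
    ([smooth_C11]), and through the symmetry of second derivatives
    ([schwarz]). *)

(** * Two-parameter remainders *)

Section BigO.
Context {R : realType}.
Variables (t0 t1 : R).
Implicit Types (p q C : R) (E F : R -> R -> R) (f : R -> R).

(** Remainders are compared for [s <= t] only, where the second level of the
    rough path is constrained. *)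
Definition bigO p E : Prop := exists C : R, forall s t,
  t0 <= s -> s <= t -> t <= t1 -> `|E s t| <= C * (t - s) `^ p.

Definition path_bounded f : Prop := exists C : R, forall t,
  t0 <= t -> t <= t1 -> `|f t| <= C.

Lemma powRD_ge0 (x : R) p q : 0 <= p -> 0 <= q ->
  x `^ (p + q) = x `^ p * x `^ q.
Proof.
move=> p0 q0; have [->|pN0] := eqVneq p 0.
  by rewrite add0r powRr0 mul1r.
apply: powRD; apply/implyP => /eqP pq0; exfalso; move/negP: pN0; apply.
by apply/eqP; lra.
Qed.

Lemma bigO_ge0 p E : bigO p E -> exists2 C : R, 0 <= C & forall s t,
  t0 <= s -> s <= t -> t <= t1 -> `|E s t| <= C * (t - s) `^ p.
Proof.
move=> [C hC]; exists (`|C|) => // s t s0 st ts.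
by apply: (le_trans (hC _ _ s0 st ts)); rewrite ler_wpM2r ?powR_ge0// ler_norm.
Qed.

Lemma bigO_dominated p E F :
  (forall s t, t0 <= s -> s <= t -> t <= t1 -> `|E s t| <= `|F s t|) ->
  bigO p F -> bigO p E.
Proof.
move=> EF [C hC]; exists C => s t s0 st ts.
by apply: (le_trans (EF _ _ s0 st ts)); exact: hC.
Qed.

Lemma eq_bigO p E F :
  (forall s t, t0 <= s -> s <= t -> t <= t1 -> E s t = F s t) ->
  bigO p F -> bigO p E.
Proof. by move=> EF; apply: bigO_dominated => s t *; rewrite EF. Qed.

Lemma bigOD p E F : bigO p E -> bigO p F -> bigO p (fun s t => E s t + F s t).
Proof.
move=> [C hC] [D hD]; exists (C + D) => s t s0 st ts.
by rewrite (le_trans (ler_normD _ _))// mulrDl lerD ?hC ?hD.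
Qed.

Lemma bigON p E : bigO p E -> bigO p (fun s t => - E s t).
Proof. by apply: bigO_dominated => s t *; rewrite normrN. Qed.

Lemma bigO0 p : bigO p (fun _ _ => 0).
Proof. by exists 0 => *; rewrite normr0 mul0r. Qed.

Lemma bigO_sum p (I : Type) (r : seq I) (E : I -> R -> R -> R) :
  (forall i, bigO p (E i)) -> bigO p (fun s t => \sum_(i <- r) E i s t).
Proof.
move=> hE; elim: r => [|i r IH].
  by apply: eq_bigO (bigO0 p) => *; rewrite big_nil.
by apply: eq_bigO (bigOD (hE i) IH) => *; rewrite big_cons.
Qed.

Lemma bigOM p q E F : 0 <= p -> 0 <= q -> bigO p E -> bigO q F ->
  bigO (p + q) (fun s t => E s t * F s t).
Proof.
move=> p0 q0 [C hC] [D hD]; exists (C * D) => s t s0 st ts.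
by rewrite normrM powRD_ge0// mulrACA ler_pM ?hC ?hD.
Qed.

Lemma bigO_weaken p q E : 0 <= p -> p <= q -> bigO q E -> bigO p E.
Proof.
move=> p0 pq /bigO_ge0[C C0 hC]; exists (C * (t1 - t0) `^ (q - p)) => s t s0 st ts.
apply: (le_trans (hC _ _ s0 st ts)).
have -> : (t - s) `^ q = (t - s) `^ (q - p) * (t - s) `^ p.
  by rewrite -powRD_ge0 ?subrK ?subr_ge0.
rewrite mulrA ler_wpM2r ?powR_ge0// ler_wpM2l//.
by rewrite ge0_ler_powR ?nnegrE ?subr_ge0//; lra.
Qed.

Lemma bounded_bigO f : path_bounded f -> bigO 0 (fun s _ => f s).
Proof.
move=> [C hC]; exists C => s t s0 st ts; rewrite powRr0 mulr1.
by apply: hC => //; exact: le_trans ts.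
Qed.

Lemma bigOMl p f E : 0 <= p -> path_bounded f -> bigO p E ->
  bigO p (fun s t => f s * E s t).
Proof.
by move=> p0 /bounded_bigO hf hE; rewrite -[p]add0r; exact: bigOM.
Qed.

Lemma bigO_id : bigO 1 (fun s t => t - s).
Proof.
exists 1 => s t s0 st ts.
by rewrite powRr1 ?subr_ge0// mul1r ger0_norm ?subr_ge0.
Qed.

Lemma bounded_of_bigO p f : 0 <= p -> t0 <= t1 ->
  bigO p (fun s t => f t - f s) -> path_bounded f.
Proof.
move=> p0 t01 /(bigO_weaken (lexx 0) p0)[C hC]; exists (C + `|f t0|) => t t0t tt1.
rewrite -{1}(subrK (f t0) (f t)) (le_trans (ler_normD _ _))// lerD2r.
by have := hC _ _ (lexx _) t0t tt1; rewrite powRr0 mulr1.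
Qed.

Lemma path_boundedD f g : path_bounded f -> path_bounded g ->
  path_bounded (fun s => f s + g s).
Proof.
move=> [C hC] [D hD]; exists (C + D) => t h h'.
by rewrite (le_trans (ler_normD _ _))// lerD ?hC ?hD.
Qed.

Lemma path_boundedM f g : path_bounded f -> path_bounded g ->
  path_bounded (fun s => f s * g s).
Proof.
move=> [C hC] [D hD]; exists (C * D) => t h h'.
by rewrite normrM ler_pM ?hC ?hD.
Qed.

(** Over [n] equal pieces the increment is at most [n * O(n^(-p))], which tends
    to [0]. *)
Lemma bigO_gt1_constant p f : 1 < p -> bigO p (fun s t => f t - f s) ->
  forall s t, t0 <= s -> s <= t -> t <= t1 -> f t = f s.
Proof.
move=> p1 /bigO_ge0[C C0 hC] s t t0s st tt1; apply/eqP; rewrite -subr_eq0 -normr_le0.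
have key n : `|f t - f s| <= C * (t - s) `^ p * (n.+1%:R `^ (p - 1))^-1.
  pose h := (t - s) / n.+1%:R.
  have h0 : 0 <= h by rewrite divr_ge0 ?subr_ge0.
  have hn : n.+1%:R * h = t - s by rewrite mulrC divfK.
  have step i : (i <= n.+1)%N ->
      `|f (s + i%:R * h) - f s| <= i%:R * (C * h `^ p).
    elim: i => [|i IH] lein; first by rewrite !mul0r addr0 subrr normr0.
    rewrite -(subrKA (f (s + i%:R * h))) (le_trans (ler_normD _ _))//.
    rewrite -[in leRHS]natr1 [in leRHS]mulrDl mul1r addrC.
    apply: lerD; first exact: IH (ltnW lein).
    have ih0 : 0 <= i%:R * h by rewrite mulr_ge0.
    have e : s + i.+1%:R * h - (s + i%:R * h) = h by rewrite -natr1; ring.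
    have le1 : i.+1%:R * h <= t - s by rewrite -hn ler_wpM2r// ler_nat.
    rewrite -{3}e; apply: hC; lra.
  have := step n.+1 (leqnn _); rewrite hn subrKC => /le_trans; apply.
  rewrite /h powRM ?subr_ge0// ?invr_ge0//.
  have n0 : (0 : R) < n.+1%:R by rewrite ltr0n.
  rewrite le_eqVlt; apply/orP; left; apply/eqP.
  have -> : (n.+1%:R^-1 : R) `^ p = n.+1%:R^-1 * (n.+1%:R `^ (p - 1))^-1.
    rewrite -invfM mulr_powRB1 ?ltW//; last by lra.
    have np0 : (n.+1%:R : R) `^ p != 0 by rewrite gt_eqF ?powR_gt0.
    apply: (mulIf np0); rewrite mulVf// -powRM ?invr_ge0 ?ler0n//.
    by rewrite mulVf ?pnatr_eq0// powR1.
  have np0 : (n.+1%:R : R) `^ (p - 1) != 0 by rewrite gt_eqF ?powR_gt0.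
  move: (_ `^ (p - 1)) np0 => Y Y0; move: (n.+1%:R : R) n0 => y y0.
  by field; rewrite Y0 gt_eqF.
have p10 : 0 < p - 1 by rewrite subr_gt0.
rewrite leNgt; apply/negP => fpos.
set D := C * (t - s) `^ p in key.
have D0 : 0 <= D by rewrite mulr_ge0 ?powR_ge0.
(* The number of pieces [n] is chosen with [n^(p-1) > D / |f t - f s|]. *)
pose y := (D / `|f t - f s|) `^ (p - 1)^-1.
have := key (Num.truncn y); apply/negP; rewrite -ltNge.
have yn : y < (Num.truncn y).+1%:R by rewrite truncnS_gt.
rewrite ltr_pdivrMr ?powR_gt0// mulrC -ltr_pdivrMr//.
have -> : D / `|f t - f s| = y `^ (p - 1).
  rewrite /y -powRrM mulVf ?gt_eqF// powRr1//.
  by rewrite divr_ge0// ltW.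
by rewrite gt0_ltr_powR ?nnegrE ?powR_ge0.
Qed.

End BigO.

(** * Sewing along dyadic partitions *)

Section Sewing.
Context {R : realType}.
Implicit Types (Xi : R -> R -> R) (a b c : R) (l : seq R).

Fixpoint path_sum Xi a l : R :=
  if l is x :: l' then Xi a x + path_sum Xi x l' else 0.

Lemma path_sum_cat Xi a l1 l2 :
  path_sum Xi a (l1 ++ l2) = path_sum Xi a l1 + path_sum Xi (last a l1) l2.
Proof. by elim: l1 a => [|x l IH] a /=; rewrite ?add0r// IH addrA. Qed.

Definition mesh_lt (d : R) a l := path (fun x y : R => y - x < d) a l.

(** For the germ of a rough integral, [I] is the integral over [a, b]. *)
Definition mesh_limit Xi a b (I : R) : Prop :=
  forall e : R, 0 < e -> exists2 d : R, 0 < d & forall l,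
    itv_partition a b l -> mesh_lt d a l -> `|path_sum Xi a l - I| < e.

Fixpoint dyadic (n : nat) a b : seq R :=
  if n is n'.+1 then
    let m := (a + b) / 2 in dyadic n' a m ++ dyadic n' m b
  else [:: b].

Lemma last_dyadic n a b : last a (dyadic n a b) = b.
Proof. by elim: n a b => //= n IH a b; rewrite last_cat !IH. Qed.

Lemma dyadic_partition n a b : a < b -> itv_partition a b (dyadic n a b).
Proof.
elim: n a b => [|n IH] a b ab /=; first exact: itv_partition1.
by apply: (@itv_partition_cat _ _ _ ((a + b) / 2)); apply: IH; lra.
Qed.

Lemma dyadic_mesh n d a b : b - a < d * 2 ^+ n -> mesh_lt d a (dyadic n a b).
Proof.
elim: n a b => [|n IH] a b /=; first by rewrite expr0 mulr1 /mesh_lt/= andbT.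
rewrite exprS mulrCA => h; rewrite /mesh_lt cat_path last_dyadic.
by apply/andP; split; apply: IH; lra.
Qed.

Lemma fine_dyadic (d a b : R) : 0 < d -> exists n, mesh_lt d a (dyadic n a b).
Proof.
move=> d0; exists (Num.truncn ((b - a) / d)); apply: dyadic_mesh.
rewrite mulrC -ltr_pdivrMr// (lt_le_trans (truncnS_gt _))//.
by rewrite -natrX ler_nat ltn_expl.
Qed.

Lemma fine_partition (d a b : R) : 0 < d -> a <= b ->
  exists2 l, itv_partition a b l & mesh_lt d a l.
Proof.
move=> d0; rewrite le_eqVlt => /predU1P[->|ab]; first by exists [::].
have [n hn] := fine_dyadic a b d0.
by exists (dyadic n a b) => //; exact: dyadic_partition.
Qed.

Section Estimate.
Variables (t0 t1 theta C : R) (Xi : R -> R -> R).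
Hypothesis theta_gt1 : 1 < theta.
Hypothesis C_ge0 : 0 <= C.
Hypothesis almost_additive : forall s u t, t0 <= s -> s <= u -> u <= t ->
  t <= t1 -> `|Xi s t - Xi s u - Xi u t| <= C * (t - s) `^ theta.

(** The fixed point of the recursion obtained by splitting an interval at its
    midpoint, so that it bounds every dyadic refinement at once. *)
Definition sewing_constant : R := C / (1 - 2 `^ (1 - theta)).

Lemma powR2_le1 : (2 : R) `^ (1 - theta) <= 1.
Proof.
have : 1 - theta <= 0 by rewrite subr_le0 ltW.
by move=> /(ler_powR (ler1n R 2)); rewrite powRr0.
Qed.

Lemma sewing_constantE :
  C + 2 * sewing_constant * 2^-1 `^ theta = sewing_constant.
Proof.
have e : (2 : R) `^ (1 - theta) = 2 * 2^-1 `^ theta.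
  rewrite powRD; last by rewrite pnatr_eq0 implybT.
  by rewrite powRr1// -powR_inv1// -powRrM mulN1r.
have lt1 : 2 * (2^-1 : R) `^ theta < 1.
  rewrite -e lt_neqAle powR_eq1; apply/andP; split.
    by rewrite pnatr_eq1 ltrn0 subr_eq0 [1 == _]lt_eqF.
  exact: powR2_le1.
rewrite /sewing_constant e; field; rewrite gt_eqF//; lra.
Qed.

Lemma sewing_constant_ge0 : 0 <= sewing_constant.
Proof.
by rewrite /sewing_constant divr_ge0// subr_ge0 powR2_le1.
Qed.

Lemma dyadic_estimate n a b : t0 <= a -> a <= b -> b <= t1 ->
  `|path_sum Xi a (dyadic n a b) - Xi a b| <= sewing_constant * (b - a) `^ theta.
Proof.
elim: n a b => [|n IH] a b t0a ab bt1.
  by rewrite /= addr0 subrr normr0 mulr_ge0 ?powR_ge0 ?sewing_constant_ge0.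
rewrite /= path_sum_cat last_dyadic; set m := (a + b) / 2.
have am : a <= m by rewrite /m; lra.
have mb : m <= b by rewrite /m; lra.
have h1 := IH a m t0a am (le_trans mb bt1).
have h2 := IH m b (le_trans t0a am) mb bt1.
have h3 := almost_additive t0a am mb bt1.
have half x : x = (b - a) / 2 ->
    x `^ theta = 2^-1 `^ theta * (b - a) `^ theta.
  by move=> ->; rewrite powRM ?subr_ge0// mulrC.
rewrite half in h1; last by rewrite /m; lra.
rewrite half in h2; last by rewrite /m; lra.
rewrite -[X in X * _ `^ _]sewing_constantE.
have -> : path_sum Xi a (dyadic n a m) + path_sum Xi m (dyadic n m b) - Xi a b
  = (path_sum Xi a (dyadic n a m) - Xi a m) +
    (path_sum Xi m (dyadic n m b) - Xi m b) - (Xi a b - Xi a m - Xi m b).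
  by ring.
rewrite (le_trans (ler_normB _ _))//.
have := ler_normD (path_sum Xi a (dyadic n a m) - Xi a m)
  (path_sum Xi m (dyadic n m b) - Xi m b).
by rewrite mulrDl; lra.
Qed.

(** A fine partition of [a, b] followed by a fine dyadic partition of [b, c]
    competes in the limits over [a, b] and over [a, c]; the two Riemann sums
    differ by the dyadic sum over [b, c] alone. *)
Lemma mesh_limit_increment_right a b c I1 I2 : t0 <= a -> a <= b -> b < c ->
  c <= t1 -> mesh_limit Xi a b I1 -> mesh_limit Xi a c I2 ->
  `|I2 - I1 - Xi b c| <= sewing_constant * (c - b) `^ theta.
Proof.
move=> t0a ab bc ct1 h1 h2; apply/ler_addgt0Pl => e e0.
have e20 : 0 < e / 2 by lra.
have [d1 d10 {}h1] := h1 _ e20; have [d2 d20 {}h2] := h2 _ e20.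
have d0 : 0 < Num.min d1 d2 by rewrite lt_min d10.
have [l pl ml] := fine_partition d0 ab.
have [n mn] := fine_dyadic b c d0.
have le1 : mesh_lt d1 a l.
  by apply: sub_path ml => x y /lt_le_trans; apply; rewrite ge_min lexx.
have le2 : mesh_lt d2 a (l ++ dyadic n b c).
  rewrite /mesh_lt cat_path; have [_ /eqP ->] := pl.
  apply/andP; split; [apply: sub_path ml|apply: sub_path mn] => x y /lt_le_trans;
    by apply; rewrite ge_min lexx orbT.
have g1 := h1 _ pl le1.
have g2 := h2 _ (itv_partition_cat pl (dyadic_partition n bc)) le2.
have g3 := dyadic_estimate n (le_trans t0a ab) (ltW bc) ct1.
rewrite path_sum_cat in g2; have [_ /eqP el] := pl; rewrite el in g2.
move: g1 g2 g3; set P := path_sum _ _ _; set Q := path_sum _ _ _ => g1 g2 g3.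
have -> : I2 - I1 - Xi b c = (P - I1) - (P + Q - I2) + (Q - Xi b c) by ring.
rewrite (le_trans (ler_normD _ _))//.
by have := ler_normB (P - I1) (P + Q - I2); lra.
Qed.

Lemma mesh_limit_increment_left a b c I1 I2 : t0 <= a -> a < b -> b <= c ->
  c <= t1 -> mesh_limit Xi a c I1 -> mesh_limit Xi b c I2 ->
  `|I1 - I2 - Xi a b| <= sewing_constant * (b - a) `^ theta.
Proof.
move=> t0a ab bc ct1 h1 h2; apply/ler_addgt0Pl => e e0.
have e20 : 0 < e / 2 by lra.
have [d1 d10 {}h1] := h1 _ e20; have [d2 d20 {}h2] := h2 _ e20.
have d0 : 0 < Num.min d1 d2 by rewrite lt_min d10.
have [l pl ml] := fine_partition d0 bc.
have [n mn] := fine_dyadic a b d0.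
have le2 : mesh_lt d2 b l.
  by apply: sub_path ml => x y /lt_le_trans; apply; rewrite ge_min lexx orbT.
have le1 : mesh_lt d1 a (dyadic n a b ++ l).
  rewrite /mesh_lt cat_path last_dyadic.
  apply/andP; split; [apply: sub_path mn|apply: sub_path ml] => x y /lt_le_trans;
    by apply; rewrite ge_min lexx.
have g1 := h1 _ (itv_partition_cat (dyadic_partition n ab) pl) le1.
have g2 := h2 _ pl le2.
have g3 := dyadic_estimate n t0a (ltW ab) (le_trans bc ct1).
rewrite path_sum_cat last_dyadic in g1.
move: g1 g2 g3; set P := path_sum _ _ _; set Q := path_sum _ _ _ => g1 g2 g3.
have -> : I1 - I2 - Xi a b = (Q - I2) - (P + Q - I1) + (P - Xi a b) by ring.
rewrite (le_trans (ler_normD _ _))//.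
by have := ler_normB (Q - I2) (P + Q - I1); lra.
Qed.

End Estimate.

End Sewing.

(** * Germs of rough integrals *)

Section ThreePoint.
Context {R : realType}.
Variables (t0 t1 : R).
Implicit Types (p q : R) (E F : R -> R -> R) (G : R -> R -> R -> R).

(** The shape of an additivity defect at an intermediate time [u]. *)
Definition bigO3 p G : Prop := exists2 C : R, 0 <= C & forall s u t,
  t0 <= s -> s <= u -> u <= t -> t <= t1 -> `|G s u t| <= C * (t - s) `^ p.

Lemma bigO3M p q E F : 0 <= p -> 0 <= q ->
  bigO t0 t1 p E -> bigO t0 t1 q F -> bigO3 (p + q) (fun s u t => E s u * F u t).
Proof.
move=> p0 q0 /bigO_ge0[C C0 hC] /bigO_ge0[D D0 hD].
exists (C * D) => [|s u t t0s su ut tt1]; first exact: mulr_ge0.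
rewrite normrM powRD_ge0// mulrACA.
apply: ler_pM => //.
  apply: (le_trans (hC _ _ t0s su (le_trans ut tt1))).
  rewrite ler_wpM2l// ge0_ler_powR ?nnegrE ?subr_ge0//; first exact: le_trans ut.
  by rewrite lerD2r.
apply: (le_trans (hD _ _ (le_trans t0s su) ut tt1)).
rewrite ler_wpM2l// ge0_ler_powR ?nnegrE ?subr_ge0//; first exact: le_trans ut.
by rewrite lerD2l lerN2.
Qed.

Lemma bigO3D p G H : bigO3 p G -> bigO3 p H ->
  bigO3 p (fun s u t => G s u t + H s u t).
Proof.
move=> [C C0 hC] [D D0 hD]; exists (C + D); first exact: addr_ge0.
move=> s u t t0s su ut tt1.
by rewrite (le_trans (ler_normD _ _))// mulrDl lerD ?hC ?hD.
Qed.

Lemma bigO3_sum p (I : Type) (r : seq I) (G : I -> R -> R -> R -> R) :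
  (forall i, bigO3 p (G i)) -> bigO3 p (fun s u t => \sum_(i <- r) G i s u t).
Proof.
move=> hG; elim: r => [|i r IH].
  by exists 0 => // *; rewrite big_nil normr0 mul0r.
have [C C0 hC] := bigO3D (hG i) IH.
by exists C => // s u t *; rewrite big_cons hC.
Qed.

End ThreePoint.

Lemma normr_coord_le (R : realType) m n (M : 'M[R]_(m, n)) i j :
  `|M i j| <= `|M|.
Proof.
by rewrite [leRHS]/Num.Def.normr/= mx_normrE; exact: (le_bigmax _ _ (i, j)).
Qed.

Lemma holder_bigO (R : realType) (alpha t0 t1 : R) (W : normedModType R)
    (Y : R -> W) : holder alpha t0 t1 Y ->
  bigO t0 t1 alpha (fun s t => `|Y t - Y s|).
Proof.
move=> [C hC]; exists C => s t t0s st tt1; rewrite normr_id.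
rewrite -[in leRHS](@ger0_norm _ (t - s)) ?subr_ge0//.
by apply: hC; rewrite in_itv/= ?t0s ?tt1 ?andbT; lra.
Qed.

Section RoughPath.
Context {R : realType} {K : nat}.
Variables (alpha t0 t1 : R) (Z : R -> 'cV[R]_K) (ZZ : R -> R -> 'M[R]_K).
Hypothesis alpha_gt : 3^-1 < alpha.
Hypothesis hZ : geometric_rough_path alpha t0 t1 Z ZZ.

Let alpha_ge0 : 0 <= alpha.
Proof. by apply: le_trans (ltW alpha_gt); rewrite invr_ge0. Qed.
Let alpha2_ge0 : 0 <= 2 * alpha. Proof. by rewrite mulr_ge0. Qed.

Lemma bigO_Z k : bigO t0 t1 alpha (fun s t => (Z t - Z s) k 0).
Proof.
apply: bigO_dominated (holder_bigO (grp_holder hZ)) => s t *.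
by rewrite normr_id normr_coord_le.
Qed.

Lemma bigO_ZZ j k : bigO t0 t1 (2 * alpha) (fun s t => ZZ s t j k).
Proof.
have [C hC] := grp_holder2 hZ; exists C => s t t0s st tt1.
exact: le_trans (normr_coord_le _ _ _) (hC _ _ t0s st tt1).
Qed.

(** Real-valued controlled paths, with the two bounds phrased as remainders so
    that they can be multiplied with those of [Z] and [ZZ]. *)
Record scalar_controlled (y : R -> R) (y' : 'I_K -> R -> R) : Prop :=
  ScalarControlled {
    sc_deriv : forall j, bigO t0 t1 alpha (fun s t => y' j t - y' j s) ;
    sc_remainder : bigO t0 t1 (2 * alpha)
      (fun s t => y t - y s - \sum_j (Z t - Z s) j 0 * y' j s)
  }.

(** The local approximation over [s, t] of the rough integral of
    [sum_k A_k dZ^k], with [A' j k] the [j]-th component of the Gubinelli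
    derivative of [A k]. *)
Definition germ (A : 'I_K -> R -> R) (A' : 'I_K -> 'I_K -> R -> R) s t : R :=
  \sum_k (Z t - Z s) k 0 * A k s + \sum_j \sum_k ZZ s t j k * A' j k s.

Section Germ.
Variables (A : 'I_K -> R -> R) (A' : 'I_K -> 'I_K -> R -> R).
Hypothesis hA : forall k, scalar_controlled (A k) (fun j => A' j k).

(** Chen's relation turns the second-level term of [ZZ s t] into exactly the
    first-order part of the increment of [A]; what is left pairs a remainder of
    order [2 alpha] with one of order [alpha]. *)
Lemma germ_almost_additive :
  bigO3 t0 t1 (3 * alpha) (fun s u t => germ A A' s t - germ A A' s u - germ A A' u t).
Proof.
have e : 3 * alpha = 2 * alpha + alpha by ring.
have e' : 3 * alpha = alpha + 2 * alpha by ring.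
have h1 : bigO3 t0 t1 (3 * alpha) (fun s u t => \sum_k
    (- (A k u - A k s - \sum_j (Z u - Z s) j 0 * A' j k s)) * (Z t - Z u) k 0).
  apply: bigO3_sum => k; rewrite e.
  apply: (bigO3M alpha2_ge0 alpha_ge0); last exact: bigO_Z.
  exact/bigON/(sc_remainder (hA k)).
have h2 : bigO3 t0 t1 (3 * alpha) (fun s u t => \sum_j \sum_k
    (- (A' j k u - A' j k s)) * ZZ u t j k).
  apply: bigO3_sum => j; apply: bigO3_sum => k; rewrite e'.
  apply: (bigO3M alpha_ge0 alpha2_ge0); last exact: bigO_ZZ.
  exact/bigON/(sc_deriv (hA k)).
have [C C0 hC] := bigO3D h1 h2; exists C => // s u t t0s su ut tt1.
apply: le_trans (hC _ _ _ t0s su ut tt1); rewrite le_eqVlt; apply/orP; left.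
apply/eqP; congr `|_|; rewrite /germ (grp_chen hZ t0s su ut tt1).
have -> : \sum_k - (A k u - A k s - \sum_j (Z u - Z s) j 0 * A' j k s)
      * (Z t - Z u) k 0
  = \sum_k (A k s - A k u) * (Z t - Z u) k 0
    + \sum_j \sum_k (Z u - Z s) j 0 * (Z t - Z u) k 0 * A' j k s.
  rewrite exchange_big/= -big_split/=; apply: eq_bigr => k _.
  transitivity ((A k s - A k u) * (Z t - Z u) k 0
    + (\sum_j (Z u - Z s) j 0 * A' j k s) * (Z t - Z u) k 0); first by ring.
  congr (_ + _); rewrite mulr_suml; apply: eq_bigr => j _; ring.
transitivity (\sum_k ((Z t - Z s) k 0 * A k s - (Z u - Z s) k 0 * A k s
      - (Z t - Z u) k 0 * A k u)
  + \sum_j \sum_k ((ZZ s u + ZZ u t + (Z u - Z s) *m (Z t - Z u)^T) j k * A' j k s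
      - ZZ s u j k * A' j k s - ZZ u t j k * A' j k u)).
  under [X in _ = _ + X]eq_bigr do rewrite !sumrB; rewrite !sumrB; ring.
rewrite -[RHS]addrA; congr (_ + _).
  by apply: eq_bigr => i _; rewrite !mxE; ring.
rewrite -big_split/=; apply: eq_bigr => j _.
rewrite -big_split/=; apply: eq_bigr => k _.
by rewrite !mxE big_ord1 !mxE; ring.
Qed.

End Germ.
End RoughPath.

(** * Increments of rough integrals *)

Section RoughIncrements.
Context {R : realType} {K : nat}.
Variables (alpha t0 t1 : R) (Z : R -> 'cV[R]_K) (ZZ : R -> R -> 'M[R]_K).
Hypothesis alpha_gt : 3^-1 < alpha.
Hypothesis hZ : geometric_rough_path alpha t0 t1 Z ZZ.

Let theta_gt1 : 1 < 3 * alpha.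
Proof. by have h := alpha_gt; lra. Qed.

Section Fixed.
Variables (A : 'I_K -> R -> R) (A' : 'I_K -> 'I_K -> R -> R) (I : R -> R).
Hypothesis hA : forall k,
  scalar_controlled alpha t0 t1 Z (A k) (fun j => A' j k).

Lemma germ_diag s : t0 <= s -> s <= t1 -> germ Z ZZ A A' s s = 0.
Proof.
have [C C0 hC] := germ_almost_additive alpha_gt hZ hA => t0s st1.
have := hC s s s t0s (lexx _) (lexx _) st1.
rewrite (subrr s) powR0 ?mulr0; last by rewrite gt_eqF//; move: theta_gt1; lra.
by rewrite normr_le0 subrr sub0r oppr_eq0 => /eqP.
Qed.

Lemma rough_increment_forward :
  (forall t, t0 <= t -> t <= t1 -> mesh_limit (germ Z ZZ A A') t0 t (I t)) ->
  bigO t0 t1 (3 * alpha) (fun s t => I t - I s - germ Z ZZ A A' s t).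
Proof.
move=> hI; have [C C0 hC] := germ_almost_additive alpha_gt hZ hA.
exists (sewing_constant (3 * alpha) C) => s t t0s st tt1.
have [<-|sNt] := eqVneq s t.
  rewrite germ_diag ?(le_trans st)// subrr subr0 normr0 mulr_ge0 ?powR_ge0//.
  exact: sewing_constant_ge0.
have slt : s < t by rewrite lt_neqAle sNt.
by apply: (mesh_limit_increment_right theta_gt1 C0 hC (lexx t0) t0s slt tt1);
  apply: hI => //; [exact: le_trans tt1|exact: le_trans st].
Qed.

Lemma rough_increment_backward :
  (forall t, t0 <= t -> t <= t1 -> mesh_limit (germ Z ZZ A A') t t1 (I t)) ->
  bigO t0 t1 (3 * alpha) (fun s t => I s - I t - germ Z ZZ A A' s t).
Proof.
move=> hI; have [C C0 hC] := germ_almost_additive alpha_gt hZ hA.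
exists (sewing_constant (3 * alpha) C) => s t t0s st tt1.
have [<-|sNt] := eqVneq s t.
  rewrite germ_diag ?(le_trans st)// subrr subr0 normr0 mulr_ge0 ?powR_ge0//.
  exact: sewing_constant_ge0.
have slt : s < t by rewrite lt_neqAle sNt.
by apply: (mesh_limit_increment_left theta_gt1 C0 hC t0s slt tt1 (lexx t1));
  apply: hI => //; [exact: le_trans tt1|exact: le_trans st].
Qed.

End Fixed.

Lemma compensated_sum_coord d (Y : 'I_K -> R -> 'cV[R]_d)
    (Y' : 'I_K -> 'I_K -> R -> 'cV[R]_d) a b l i :
  compensated_sum Z ZZ Y Y' a b l i 0 =
  path_sum (germ Z ZZ (fun k s => Y k s i 0) (fun j k s => Y' j k s i 0)) a l.
Proof.
rewrite /compensated_sum; elim: l a => [|x l IH] a.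
  by rewrite big_geq// mxE.
rewrite /= big_nat_recl// mxE -IH; congr (_ + _).
rewrite /germ mxE !summxE; congr (_ + _); apply: eq_bigr => j _.
  by rewrite mxE.
by rewrite summxE; apply: eq_bigr => k _; rewrite mxE.
Qed.

Lemma rough_integral_coord d (Y : 'I_K -> R -> 'cV[R]_d)
    (Y' : 'I_K -> 'I_K -> R -> 'cV[R]_d) a b (I : 'cV[R]_d) i :
  is_rough_integral Z ZZ Y Y' a b I ->
  mesh_limit (germ Z ZZ (fun k s => Y k s i 0) (fun j k s => Y' j k s i 0))
    a b (I i 0).
Proof.
move=> hI e e0; have [d' d'0 hd] := hI e e0; exists d' => // l pl ml.
apply: le_lt_trans (hd l pl _).
  rewrite -(compensated_sum_coord _ _ a b).
  by apply: le_trans (normr_coord_le _ i 0); rewrite !mxE.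
by move=> j jl; move/(pathP b): ml => /(_ j jl).
Qed.

End RoughIncrements.

(** * Functions with locally Lipschitz derivative *)

Section C11.
Context {R : realType}.
Implicit Types V : normedModType R.

(** The regularity that the rough estimates use.  Unlike the classes [Ck n] it
    passes to products by a single application of the Leibniz rule. *)
Definition C11 V (F : V -> R) : Prop :=
  (forall x, differentiable F x) /\
  forall M : R, exists C : R, forall x y v : V, `|x| <= M -> `|y| <= M ->
    `|'D_v F y - 'D_v F x| <= C * `|y - x| * `|v|.

Lemma is_derive_line V (F : V -> R) (x v : V) (h : R) :
  differentiable F (x + h *: v) ->
  is_derive h 1 (fun h : R => F (x + h *: v)) ('D_v F (x + h *: v)).
Proof.
move=> dF.
have dl : is_diff h (fun h : R => x + h *: v) (fun h => 0 + h *: v).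
  by apply: is_diffD.
have dF' : differentiable F ((fun h : R => x + h *: v) h) by [].
have dc : differentiable (fun h : R => F (x + h *: v)) h.
  by apply: (@differentiable_comp _ _ _ _ (fun h : R => x + h *: v) F).
split; first exact/derivable1_diffP.
rewrite [LHS]deriveE// (@diff_comp _ _ _ _ (fun h : R => x + h *: v) F)//=.
by rewrite deriveE// diff_val/= add0r scale1r.
Qed.

Lemma mean_value V (F : V -> R) (x v : V) : (forall y, differentiable F y) ->
  exists2 c : R, 0 <= c <= 1 & F (x + v) - F x = 'D_v F (x + c *: v).
Proof.
move=> dF.
have dl (h : R) := is_derive_line (dF (x + h *: v)).
have [|h c01] := @MVT_segment R (fun h => F (x + h *: v))
  (fun h => 'D_v F (x + h *: v)) 0 1 ler01 (fun h _ => dl h).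
  apply: derivable_within_continuous => h _; exact: (@ex_derive _ _ _ _ _ _ _ (dl h)).
rewrite scale0r addr0 scale1r subr0 mulr1 => ->.
by exists h; rewrite in_itv/= in c01.
Qed.

Lemma normr_segment V (x y : V) (c M : R) : `|x| <= M -> `|y| <= M ->
  0 <= c -> c <= 1 -> `|x + c *: (y - x)| <= M.
Proof.
move=> xM yM c0 c1; have -> : x + c *: (y - x) = (1 - c) *: x + c *: y.
  by rewrite scalerBr scalerBl scale1r [_ *: y - _]addrC addrA.
rewrite (le_trans (ler_normD _ _))// !normrZ !ger0_norm ?subr_ge0//.
apply: (@le_trans _ _ ((1 - c) * M + c * M)); last by rewrite -mulrDl subrK mul1r.
by rewrite lerD ?ler_wpM2l ?subr_ge0.
Qed.

Lemma C11_derive_bound V (F : V -> R) : C11 F ->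
  forall M : R, exists2 C : R, 0 <= C &
    forall x v, `|x| <= M -> `|'D_v F x| <= C * `|v|.
Proof.
move=> [dF LF] M; have [C hC] := LF `|M|.
have [k k0 hk] := linear_lipschitz (diff_continuous (dF 0)).
exists (`|C| * `|M| + k); first by rewrite addr_ge0 ?mulr_ge0// ltW.
move=> x v xM; rewrite -(subrK ('D_v F 0) ('D_v F x)).
rewrite (le_trans (ler_normD _ _))// mulrDl lerD//; last by rewrite deriveE.
have xM' : `|x| <= `|M| by apply: le_trans xM (ler_norm _).
apply: (le_trans (hC 0 x v _ xM')); first by rewrite normr0.
rewrite subr0 ler_wpM2r// (le_trans (_ : _ <= `|C| * `|x|))//.
  by rewrite ler_wpM2r// ler_norm.
by rewrite ler_wpM2l.
Qed.

Lemma C11_taylor V (F : V -> R) : C11 F ->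
  forall M : R, exists2 C : R, 0 <= C &
    forall x y, `|x| <= M -> `|y| <= M ->
    `|F y - F x - 'D_(y - x) F x| <= C * `|y - x| ^+ 2.
Proof.
move=> [dF LF] M; have [C hC] := LF M.
exists `|C| => // x y xM yM.
have [c /andP[c0 c1]] := mean_value x (y - x) dF.
rewrite subrKC => ->.
have zM := normr_segment xM yM c0 c1.
apply: (le_trans (hC _ _ _ xM zM)).
rewrite addrC addKr normrZ (ger0_norm c0) expr2 [leRHS]mulrA ler_wpM2r//.
rewrite (le_trans (_ : _ <= `|C| * (c * `|y - x|)))//.
  by rewrite ler_wpM2r ?ler_norm// mulr_ge0.
by rewrite ler_wpM2l// ler_piMl.
Qed.

End C11.

Section C11Closure.
Context {R : realType}.
Implicit Types V : normedModType R.

Lemma C11_lipschitz V (F : V -> R) : C11 F ->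
  forall M : R, exists2 C : R, 0 <= C &
    forall x y, `|x| <= M -> `|y| <= M -> `|F y - F x| <= C * `|y - x|.
Proof.
move=> hF M; have [C C0 hC] := C11_taylor hF M.
have [D D0 hD] := C11_derive_bound hF M.
exists (C * (`|M| + `|M|) + D) => [|x y xM yM].
  by rewrite addr_ge0 ?mulr_ge0 ?addr_ge0.
rewrite -(subrK ('D_(y - x) F x) (F y - F x)) (le_trans (ler_normD _ _))//.
rewrite mulrDl lerD ?hD//; apply: (le_trans (hC _ _ xM yM)).
rewrite expr2 mulrA ler_wpM2r// ler_wpM2l// (le_trans (ler_normB _ _))//.
by rewrite lerD// (le_trans _ (ler_norm _)).
Qed.

Lemma C11_bounded V (F : V -> R) : C11 F ->
  forall M : R, exists2 C : R, 0 <= C & forall x, `|x| <= M -> `|F x| <= C.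
Proof.
move=> hF M; have [C C0 hC] := C11_lipschitz hF `|M|.
exists (C * `|M| + `|F 0|) => [|x xM]; first by rewrite addr_ge0 ?mulr_ge0.
have xM' : `|x| <= `|M| by apply: le_trans xM (ler_norm _).
rewrite -(subrK (F 0) (F x)) (le_trans (ler_normD _ _))// lerD2r.
apply: le_trans (hC 0 x _ xM') _; first by rewrite normr0.
by rewrite subr0 ler_wpM2l.
Qed.

Lemma C11D V (F G : V -> R) : C11 F -> C11 G -> C11 (fun x => F x + G x).
Proof.
move=> [dF LF] [dG LG]; split; first by move=> x; exact: differentiableD.
move=> M; have [C hC] := LF M; have [D hD] := LG M.
exists (C + D) => x y v xM yM.
have e z : 'D_v (fun x => F x + G x) z = 'D_v F z + 'D_v G z.
  by apply: deriveD; exact: diff_derivable.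
rewrite !e opprD addrACA (le_trans (ler_normD _ _))// !mulrDl.
by apply: lerD; [exact: hC|exact: hD].
Qed.

Lemma C11_cst V (a : R) : C11 (fun _ : V => a).
Proof.
split=> [x|M]; first exact: differentiable_cst.
by exists 0 => x y v _ _; rewrite !derive_cst subrr normr0 !mul0r.
Qed.

Lemma C11_sum V (I : Type) (r : seq I) (F : I -> V -> R) :
  (forall i, C11 (F i)) -> C11 (fun x => \sum_(i <- r) F i x).
Proof.
move=> hF; elim: r => [|i r IH].
  under eq_fun do rewrite big_nil; exact: C11_cst.
under eq_fun do rewrite big_cons; exact: C11D.
Qed.

Lemma C11M V (F G : V -> R) : C11 F -> C11 G -> C11 (fun x => F x * G x).
Proof.
move=> hF hG; have [dF LF] := hF; have [dG LG] := hG.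
split=> [x|M]; first exact: differentiableM.
have [CF hCF] := LF M; have [CG hCG] := LG M.
have [BF BF0 hBF] := C11_bounded hF M; have [BG BG0 hBG] := C11_bounded hG M.
have [DF DF0 hDF] := C11_derive_bound hF M.
have [DG DG0 hDG] := C11_derive_bound hG M.
have [KF KF0 hKF] := C11_lipschitz hF M; have [KG KG0 hKG] := C11_lipschitz hG M.
exists ((BF * CG + KF * DG) + (BG * CF + KG * DF)) => x y v xM yM.
have e z : 'D_v (fun x => F x * G x) z = F z * 'D_v G z + G z * 'D_v F z.
  by apply: deriveM; exact: diff_derivable.
rewrite !e.
have -> : F y * 'D_v G y + G y * 'D_v F y - (F x * 'D_v G x + G x * 'D_v F x) =
  (F y * ('D_v G y - 'D_v G x) + (F y - F x) * 'D_v G x) +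
  (G y * ('D_v F y - 'D_v F x) + (G y - G x) * 'D_v F x) by ring.
have P (A B a b : R) : `|A| <= a -> `|B| <= b -> `|A * B| <= a * b.
  by move=> hA hB; rewrite normrM ler_pM.
have mD (a b c d : R) : (a + b) * c * d = a * c * d + b * c * d by ring.
rewrite (le_trans (ler_normD _ _))// !mD.
apply: lerD; apply: le_trans (ler_normD _ _) _; apply: lerD.
- apply: le_trans (P _ _ _ _ (hBF _ yM) (hCG _ _ v xM yM)) _.
  by rewrite !mulrA.
- apply: le_trans (P _ _ _ _ (hKF _ _ xM yM) (hDG _ v xM)) _.
  by rewrite mulrACA mulrA.
- apply: le_trans (P _ _ _ _ (hBG _ yM) (hCF _ _ v xM yM)) _.
  by rewrite !mulrA.
- apply: le_trans (P _ _ _ _ (hKG _ _ xM yM) (hDF _ v xM)) _.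
  by rewrite mulrACA mulrA.
Qed.

Lemma linear_differential V (F : V -> R) : linear F -> continuous F ->
  forall x, differentiable F x /\ forall v, 'd F x v = F v.
Proof.
move=> lF cF x.
pose lM := GRing.isLinear.Build _ _ _ _ F lF.
pose L : {linear V -> R} := HB.pack F lM.
split; first exact: (@linear_differentiable _ _ _ L x cF).
by move=> v; rewrite (@diff_lin _ _ _ L x cF).
Qed.

Lemma C11_linear V (F : V -> R) : linear F -> continuous F -> C11 F.
Proof.
move=> lF cF; have d := linear_differential lF cF; split=> [x|M].
  exact: (d x).1.
exists 0 => x y v _ _; rewrite (deriveE _ (d x).1) (deriveE _ (d y).1).
by rewrite (d x).2 (d y).2 subrr normr0 !mul0r.
Qed.

Lemma C11_fst V V' (F : V -> R) : C11 F -> C11 (fun y : V * V' => F y.1).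
Proof.
move=> [dF LF]; split=> [x|M].
  apply: (@differentiable_comp _ _ _ _ (fst : V * V' -> V) F) => //.
  by apply: linear_differentiable => z; exact: cvg_fst.
have [C hC] := LF M; exists `|C| => x y v xM yM.
have fst_le (z : V * V') : `|z.1| <= `|z| by rewrite prod_normE le_max lexx.
have := hC x.1 y.1 v.1 (le_trans (fst_le x) xM) (le_trans (fst_le y) yM).
move=> /le_trans; apply; apply: (@le_trans _ _ (`|C| * `|(y - x).1| * `|v.1|)).
  by rewrite !ler_wpM2r// ler_norm.
by rewrite ler_pM ?mulr_ge0// ler_wpM2l.
Qed.


Lemma derive_shifted V (F : V -> R) (a v x : V) :
  'D_v (fun y => F (y + a)) x = 'D_v F (x + a).
Proof. by rewrite /derive; under eq_fun do rewrite /= -addrA. Qed.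

Lemma differentiable_shifted V (F : V -> R) (a : V) :
  (forall x, differentiable F x) -> forall x, differentiable (fun y => F (y + a)) x.
Proof.
move=> dF x; apply: (@differentiable_comp _ _ _ _ (fun y : V => y + a) F) => //.
Qed.

Lemma derive_scale V (F : V -> R) (h : R) (v x : V) : differentiable F x ->
  'D_(h *: v) F x = h * 'D_v F x.
Proof. by move=> dF; rewrite !deriveE// linearZ. Qed.

Lemma continuous_dist V (g : V -> R) (x : V) (e : R) : continuous g -> 0 < e ->
  exists2 d : R, 0 < d & forall z, `|z - x| < d -> `|g z - g x| < e.
Proof.
move=> cg e0; have /cvgrPdist_lt/(_ e e0)/nbhs_ballP[d /= d0 hd] := cg x.
exists d => // z zx; rewrite distrC; apply: hd.
by rewrite -ball_normE/= distrC.
Qed.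

(** Two limits agree as soon as the functions share values arbitrarily close to
    the point, possibly attained at different places. *)
Lemma eq_of_nearby_values V (P Q : V -> R) (x : V) (m : R) :
  continuous P -> continuous Q -> 0 <= m ->
  (forall h : R, 0 < h ->
     exists z1 z2, [/\ P z1 = Q z2, `|z1 - x| <= h * m & `|z2 - x| <= h * m]) ->
  P x = Q x.
Proof.
move=> cP cQ m0 near_x.
apply/eqP; rewrite -subr_eq0 -normr_le0; apply/ler_addgt0Pl => e e0.
have e20 : 0 < e / 2 by rewrite divr_gt0.
have [d1 d10 hd1] := continuous_dist x cP e20.
have [d2 d20 hd2] := continuous_dist x cQ e20.
have d0 : 0 < Num.min d1 d2 by rewrite lt_min d10.
pose h := Num.min d1 d2 / (m + 1).
have h0 : 0 < h by rewrite divr_gt0// ltr_wpDl.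
have hm : h * m < Num.min d1 d2.
  by rewrite /h mulrAC ltr_pdivrMr ?ltr_wpDl// ltr_pM2l// ltrDl.
have [z1 [z2 [ez /le_lt_trans/(_ hm) + /le_lt_trans/(_ hm)]]] := near_x h h0.
rewrite !lt_min => /andP[/hd1 + _] /andP[_ /hd2].
rewrite ez; move: (P x) (Q x) (Q z2) => p q r b1 b2.
have -> : p - q = (r - q) - (r - p) by ring.
by rewrite (le_trans (ler_normB _ _))//; lra.
Qed.

(** Both iterated derivatives are values, near [x], of one and the same second
    difference divided by the square of the step. *)
Lemma schwarz V (F : V -> R) (u v x : V) : Ck 2 F ->
  'D_u ('D_v F) x = 'D_v ('D_u F) x.
Proof.
move=> [dF ddF].
have second_difference u' v' h : exists2 z,
    F (x + h *: v' + h *: u') - F (x + h *: v') - (F (x + h *: u') - F x)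
      = h * (h * 'D_u' ('D_v' F) z) &
    `|z - x| <= `|h| * (`|u'| + `|v'|).
  have dphi y : differentiable (fun y => F (y + h *: u') - F y) y.
    by apply: differentiableB => //; exact: differentiable_shifted.
  have [c1 /andP[c10 c11] ->] := mean_value x (h *: v') dphi.
  have [c2 /andP[c20 c21] e2] :=
    mean_value (x + c1 *: (h *: v')) (h *: u') (ddF v').1.
  exists (x + c1 *: (h *: v') + c2 *: (h *: u')).
    rewrite -[h * 'D_u' _ _]derive_scale; last exact: (ddF v').1.
    rewrite -e2 deriveB; last 2 first.
    - exact/diff_derivable/differentiable_shifted.
    - exact: diff_derivable.
    by rewrite derive_shifted !derive_scale// mulrBr.
  rewrite -[x + _ + _]addrA [x + _]addrC addrK (le_trans (ler_normD _ _))//.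
  rewrite !normrZ addrC mulrDr.
  by apply: lerD; rewrite ler_piMl ?mulr_ge0// ger0_norm.
have cancel h (A B : R) : 0 < h -> h * (h * A) = h * (h * B) -> A = B.
  by move=> /lt0r_neq0 hN0 /(mulfI hN0)/(mulfI hN0).
have swap (A B C D : R) : A - B - (C - D) = A - C - (B - D) by ring.
apply: (eq_of_nearby_values (m := `|u| + `|v|) ((ddF v).2 u) ((ddF u).2 v)).
  exact: addr_ge0.
move=> h h0; have [z1 e1 b1] := second_difference u v h.
have [z2 e2 b2] := second_difference v u h.
rewrite (gtr0_norm h0) in b1 b2.
exists z1, z2; split; [|exact: b1|by rewrite [`|u| + _]addrC; exact: b2].
have ec : x + h *: u + h *: v = x + h *: v + h *: u by rewrite addrAC.
rewrite ec in e2.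
exact: (cancel h _ _ h0 (etrans (esym e1) (etrans (swap _ _ _ _) e2))).
Qed.

End C11Closure.

(** * Smooth functions on the cotangent space *)

Lemma sum_pair (V W : nmodType) (I : Type) (r : seq I) (A : I -> V) (B : I -> W) :
  \sum_(i <- r) ((A i, B i) : V * W) = (\sum_(i <- r) A i, \sum_(i <- r) B i).
Proof. by elim/big_rec3 : _ => // i a b s _ ->. Qed.

Section SmoothC11.
Context {R : realType}.

Lemma continuous_bounded_on (V : normedModType R) (S : set V) (f : V -> R) :
  continuous f -> compact S ->
  exists2 B : R, 0 <= B & forall x, S x -> `|f x| <= B.
Proof.
move=> cf cS; have cfS : compact (f @` S).
  by apply: continuous_compact => //; exact: continuous_subspaceT.
have [B [_ hB]] := compact_bounded cfS.
exists `|B + 1| => // x Sx; apply: le_trans (ler_norm _).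
by apply: hB; [rewrite ltrDl|exists x].
Qed.

(** Second derivatives along a basis are bounded on bounded sets; the mean
    value theorem turns this into the Lipschitz estimate for the first ones. *)
Lemma Ck2_C11 (V : normedModType R) (I : finType) (e : I -> V) (c : I -> V -> R)
    (F : V -> R) :
  (forall v, v = \sum_i c i v *: e i) -> (forall i v, `|c i v| <= `|v|) ->
  (forall M : R, exists2 S : set V, compact S & forall x, `|x| <= M -> S x) ->
  Ck 2 F -> C11 F.
Proof.
move=> ce c_le cpt [dF ddF]; split=> // M.
have derive_basis (G : V -> R) x v : differentiable G x ->
    'D_v G x = \sum_i c i v * 'D_(e i) G x.
  move=> dG; rewrite deriveE// {1}(ce v) linear_sum.
  by apply: eq_bigr => i _; rewrite linearZ/= deriveE.
have [S cS hS] := cpt M.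
have hB i j := continuous_bounded_on ((ddF (e i)).2 (e j)) cS.
pose B i j := sval (cid2 (hB i j)).
have B0 i j : 0 <= B i j by rewrite /B; case: cid2.
have BP i j x : S x -> `|'D_(e j) ('D_(e i) F) x| <= B i j.
  by rewrite /B; case: cid2 => b /= _; apply.
exists (\sum_i \sum_j B i j) => x y v xM yM.
have step i : `|'D_(e i) F y - 'D_(e i) F x| <= (\sum_j B i j) * `|y - x|.
  have [t /andP[t0 t1]] := mean_value x (y - x) (ddF (e i)).1.
  rewrite subrKC => ->; have zM := normr_segment xM yM t0 t1.
  rewrite derive_basis; last exact: (ddF (e i)).1.
  apply: (le_trans (ler_norm_sum _ _ _)); rewrite mulr_suml.
  apply: ler_sum => j _; rewrite normrM mulrC.
  by apply: ler_pM (c_le _ _) => //; exact: BP (hS _ zM).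
rewrite (derive_basis _ _ v (dF y)) (derive_basis _ _ v (dF x)) -sumrB.
apply: (le_trans (ler_norm_sum _ _ _)); rewrite !mulr_suml.
apply: ler_sum => i _; rewrite -mulrBr normrM mulrC.
exact: ler_pM (step i) (c_le _ _).
Qed.

(** Directional derivatives are computed entrywise, so the induction on the order
    commutes with taking an entry. *)
Lemma Ck_coord (V : normedModType R) m n (F : V -> 'M[R]_(m, n)) i j k :
  Ck k F -> Ck k (fun x => F x i j).
Proof.
elim: k F => [|k IH] F /=.
  move=> cF x; apply: (@continuous_comp _ _ _ F (fun M : 'M[R]_(m, n) => M i j)).
    exact: cF.
  exact: coord_continuous.
move=> [dF hF]; split=> [x|v].
  exact: (differentiable_comp (dF x) (differentiable_coord (F x) i j)).
have -> : (fun x => 'D_v (fun y => F y i j) x) = (fun x => ('D_v F x) i j).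
  apply/funext => x; rewrite derive_mx; last exact: diff_derivable.
  by rewrite mxE.
exact: IH (hF v).
Qed.

Lemma smooth_coord (V : normedModType R) m n (F : V -> 'M[R]_(m, n)) i j :
  smooth F -> smooth (fun x => F x i j).
Proof. by move=> sF k; exact: Ck_coord. Qed.

Lemma smooth_derive (V : normedModType R) (F : V -> R) v :
  smooth F -> smooth ('D_v F).
Proof. by move=> sF k; exact: (sF k.+1).2 v. Qed.

End SmoothC11.

Section Cotangent.
Context {R : realType} {N : nat}.

(** Tychonoff's theorem for row vectors, transported along the transposition. *)
Lemma cV_ball_compact (M : R) :
  exists2 S : set 'cV[R]_N, compact S & forall x, `|x| <= M -> S x.
Proof.
pose A := [set v : 'rV[R]_N | forall i, `[- M, M]%classic (v ord0 i)].
have cA : compact A.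
  by apply: (@rV_compact _ _ (fun=> `[- M, M]%classic)) => _; exact: segment_compact.
exists ((fun v : 'rV[R]_N => v^T) @` A).
  apply: (continuous_compact _ cA); apply: continuous_subspaceT => v.
  move=> B /nbhs_ballP[e e0 hB]; apply/nbhs_ballP; exists e => // w [_ vw].
  by apply: hB; split=> // i j; rewrite !mxE; exact: vw.
move=> x xM; exists x^T; last exact: trmxK.
move=> i /=; rewrite mxE in_itv/= -ler_norml.
exact: le_trans (normr_coord_le x i 0) xM.
Qed.

Lemma cotangent_ball_compact (M : R) :
  exists2 S : set (cotangent R N), compact S & forall x, `|x| <= M -> S x.
Proof.
have [S cS hS] := cV_ball_compact M.
exists (S `*` S); first exact: compact_setX.
by move=> x; rewrite prod_normE ge_max => /andP[x1 x2]; split; apply: hS.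
Qed.

Lemma smooth_C11 (F : cotangent R N -> R) : smooth F -> C11 F.
Proof.
move=> sF; apply: (@Ck2_C11 _ _ ('I_N + 'I_N)%type
  (fun i => match i with inl i => basis_q i | inr i => basis_p i end)
  (fun i v => match i with inl i => v.1 i 0 | inr i => v.2 i 0 end)).
- move=> [q p]; rewrite big_sumType/=.
  rewrite (eq_bigr (fun i => (q i 0 *: delta_mx i 0, 0))); last first.
    by move=> i _; apply: injective_projections; rewrite /= ?scaler0.
  rewrite [X in _ + X](eq_bigr (fun i => (0, p i 0 *: delta_mx i 0))); last first.
    by move=> i _; apply: injective_projections; rewrite /= ?scaler0.
  have colE (u : 'cV[R]_N) : u = \sum_i u i 0 *: delta_mx i 0.
    by rewrite {1}[u]matrix_sum_delta; apply: eq_bigr => i _; rewrite big_ord1.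
  rewrite !sum_pair !big1_eq -!colE.
  by apply: injective_projections; rewrite /= ?addr0 ?add0r.
- case=> i v; apply: le_trans (normr_coord_le _ _ _) _;
    by rewrite prod_normE le_max lexx ?orbT.
- exact: cotangent_ball_compact.
- exact: sF.
Qed.

End Cotangent.

(** * Smooth functions of controlled paths *)

Lemma derive_dirB (R : realType) (V : normedModType R) (F : V -> R) (x u v : V) :
  differentiable F x -> 'D_(u - v) F x = 'D_u F x - 'D_v F x.
Proof. by move=> dF; rewrite !deriveE// linearB. Qed.

Section Composition.
Context {R : realType} {K : nat}.
Variables (alpha t0 t1 : R) (Z : R -> 'cV[R]_K) (ZZ : R -> R -> 'M[R]_K).
Hypotheses (alpha_gt : 3^-1 < alpha) (t0_lt_t1 : t0 < t1).
Hypothesis hZ : geometric_rough_path alpha t0 t1 Z ZZ.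

Let alpha_ge0 : 0 <= alpha.
Proof. by apply: le_trans (ltW alpha_gt); rewrite invr_ge0. Qed.

Lemma holder_bounded (V : normedModType R) (Y : R -> V) :
  bigO t0 t1 alpha (fun s t => `|Y t - Y s|) ->
  path_bounded t0 t1 (fun s => `|Y s|).
Proof.
move=> hY; apply: (bounded_of_bigO alpha_ge0 (ltW t0_lt_t1)).
by apply: bigO_dominated hY => s t *; rewrite normr_id ler_dist_dist.
Qed.

Section Controlled.
Variables (V : normedModType R) (X : R -> V) (X' : 'I_K -> R -> V).
Hypothesis hX : controlled alpha t0 t1 Z X X'.

Lemma controlled_deriv_bounded j : path_bounded t0 t1 (fun s => `|X' j s|).
Proof. exact/holder_bounded/holder_bigO/(controlled_deriv hX). Qed.

Lemma controlled_remainder_bigO : bigO t0 t1 (2 * alpha)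
  (fun s t => `|X t - X s - \sum_j (Z t - Z s) j 0 *: X' j s|).
Proof.
have [C hC] := controlled_remainder hX; exists C => s t t0s st tt1.
by rewrite normr_id; exact: hC.
Qed.

Lemma controlled_increment : bigO t0 t1 alpha (fun s t => `|X t - X s|).
Proof.
have h1 : bigO t0 t1 alpha
    (fun s t => `|X t - X s - \sum_j (Z t - Z s) j 0 *: X' j s|).
  apply: bigO_weaken controlled_remainder_bigO => //.
  by rewrite ler_peMl// ler1n.
have h2 : bigO t0 t1 alpha (fun s t => \sum_j `|X' j s| * `|(Z t - Z s) j 0|).
  apply: bigO_sum => j; apply: bigOMl (controlled_deriv_bounded j) _ => //.
  by apply: bigO_dominated (bigO_Z hZ j) => s t *; rewrite normr_id.
apply: bigO_dominated (bigOD h1 h2) => s t *.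
rewrite normr_id [leRHS]ger0_norm ?addr_ge0 ?sumr_ge0//.
rewrite -{1}(subrK (\sum_j (Z t - Z s) j 0 *: X' j s) (X t - X s)).
rewrite (le_trans (ler_normD _ _))// lerD2l (le_trans (ler_norm_sum _ _ _))//.
by apply: ler_sum => j _; rewrite normrZ mulrC.
Qed.

Lemma controlled_bounded : exists M : R, forall t, t0 <= t -> t <= t1 -> `|X t| <= M.
Proof.
have [M hM] := holder_bounded controlled_increment; exists M => t h h'.
by rewrite -normr_id hM.
Qed.

(** The chain rule to first order: the quadratic Taylor remainder is of order
    [2 alpha] because the increments of [X] are of order [alpha]. *)
Lemma C11_controlled (F : V -> R) : C11 F ->
  scalar_controlled alpha t0 t1 Z (fun s => F (X s))
    (fun j s => 'D_(X' j s) F (X s)).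
Proof.
move=> hF; have [dF LF] := hF; have [M hM] := controlled_bounded.
have [C hC] := LF M; have [T T0 hT] := C11_taylor hF M.
have [D D0 hD] := C11_derive_bound hF M.
split=> [j|].
  have [B hB] := controlled_deriv_bounded j.
  have h1 : bigO t0 t1 alpha
      (fun s t => `|C| * `|X t - X s| * `|B|).
    have [c hc] := controlled_increment; exists (`|C| * c * `|B|) => s t t0s st tt1.
    rewrite !normrM !normr_id [leRHS]mulrAC ler_wpM2r// -mulrA ler_wpM2l//.
    by have := hc s t t0s st tt1; rewrite normr_id.
  have h2 : bigO t0 t1 alpha (fun s t => D * `|X' j t - X' j s|).
    have [c hc] := holder_bigO (controlled_deriv hX j).
    exists (D * c) => s t t0s st tt1.
    by rewrite normrM (ger0_norm D0) -mulrA ler_wpM2l// hc.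
  apply: bigO_dominated (bigOD h1 h2) => s t t0s st tt1.
  have Xs := hM _ t0s (le_trans st tt1); have Xt := hM _ (le_trans t0s st) tt1.
  rewrite [leRHS]ger0_norm ?addr_ge0 ?mulr_ge0//.
  have -> : 'D_(X' j t) F (X t) - 'D_(X' j s) F (X s) =
    ('D_(X' j t) F (X t) - 'D_(X' j t) F (X s)) + 'D_(X' j t - X' j s) F (X s).
    by rewrite derive_dirB// addrA subrK.
  apply: le_trans (ler_normD _ _) _; apply: lerD; last exact: hD.
  apply: le_trans (hC _ _ _ Xs Xt) _.
  have b : `|X' j t| <= `|B|.
    by rewrite -normr_id (le_trans (hB _ (le_trans t0s st) tt1)) ?ler_norm.
  apply: (@le_trans _ _ (`|C| * `|X t - X s| * `|X' j t|)).
    by rewrite !ler_wpM2r// ler_norm.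
  by rewrite ler_wpM2l// mulr_ge0.
have h1 : bigO t0 t1 (2 * alpha) (fun s t => T * (`|X t - X s| * `|X t - X s|)).
  have -> : 2 * alpha = alpha + alpha by ring.
  have [c hc] := bigOM alpha_ge0 alpha_ge0 controlled_increment controlled_increment.
  exists (T * c) => s t t0s st tt1.
  by rewrite normrM (ger0_norm T0) -mulrA ler_wpM2l// hc.
have h2 : bigO t0 t1 (2 * alpha)
    (fun s t => D * `|X t - X s - \sum_j (Z t - Z s) j 0 *: X' j s|).
  have [c hc] := controlled_remainder_bigO.
  exists (D * c) => s t t0s st tt1.
  by rewrite normrM (ger0_norm D0) -mulrA ler_wpM2l// hc.
apply: bigO_dominated (bigOD h1 h2) => s t t0s st tt1.
have Xs := hM _ t0s (le_trans st tt1); have Xt := hM _ (le_trans t0s st) tt1.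
rewrite [leRHS]ger0_norm ?addr_ge0 ?mulr_ge0//.
have e : 'D_(X t - X s - \sum_j (Z t - Z s) j 0 *: X' j s) F (X s) =
    'D_(X t - X s) F (X s) - \sum_j (Z t - Z s) j 0 * 'D_(X' j s) F (X s).
  rewrite derive_dirB//; congr (_ - _); rewrite deriveE// linear_sum.
  by apply: eq_bigr => j _; rewrite -deriveE// derive_scale.
have -> : F (X t) - F (X s) - \sum_j (Z t - Z s) j 0 * 'D_(X' j s) F (X s) =
  (F (X t) - F (X s) - 'D_(X t - X s) F (X s)) +
  'D_(X t - X s - \sum_j (Z t - Z s) j 0 *: X' j s) F (X s).
  by rewrite e addrA subrK.
apply: le_trans (ler_normD _ _) _; apply: lerD; last exact: hD.
by rewrite -expr2; exact: hT.
Qed.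

End Controlled.

Lemma controlled_pair (V V' : normedModType R) (X : R -> V) (X' : 'I_K -> R -> V)
    (Y : R -> V') (Y' : 'I_K -> R -> V') :
  controlled alpha t0 t1 Z X X' -> controlled alpha t0 t1 Z Y Y' ->
  controlled alpha t0 t1 Z (fun r => (X r, Y r)) (fun j r => (X' j r, Y' j r)).
Proof.
move=> [hX [C hC]] [hY [D hD]].
have pair_le (a : V) (b : V') : `|(a, b)| <= `|a| + `|b|.
  by rewrite prod_normE/= ge_max lerDl lerDr !normr_ge0.
split=> [j|].
  have [c hc] := hX j; have [d hd] := hY j; exists (c + d) => s t ss tt.
  apply: le_trans (pair_le _ _) _.
  by rewrite mulrDl; apply: lerD; [exact: hc|exact: hd].
exists (C + D) => s t t0s st tt1.
have -> : (X t, Y t) - (X s, Y s) - \sum_j (Z t - Z s) j 0 *: (X' j s, Y' j s) =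
  (X t - X s - \sum_j (Z t - Z s) j 0 *: X' j s,
   Y t - Y s - \sum_j (Z t - Z s) j 0 *: Y' j s).
  by rewrite -[LHS]/((X t - X s, Y t - Y s) -
    \sum_j ((Z t - Z s) j 0 *: X' j s, (Z t - Z s) j 0 *: Y' j s)) sum_pair.
apply: le_trans (pair_le _ _) _.
by rewrite mulrDl; apply: lerD; [exact: hC|exact: hD].
Qed.

End Composition.

(** * Drift integrals of Hoelder functions *)

Section Drift.
Context {R : realType}.
Variables (alpha t0 t1 : R) (f : R -> R).
Hypothesis alpha_gt0 : 0 < alpha.
Hypothesis hf : bigO t0 t1 alpha (fun s t => f t - f s).

Lemma holder_continuous a b : t0 <= a -> b <= t1 ->
  {within `[a, b], continuous f}.
Proof.
move=> t0a bt1; apply/subspace_continuousP => x /= xab.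
have [C C0 hC] := bigO_ge0 hf.
have C1 : 0 < C + 1 by rewrite ltr_wpDl.
apply/cvgrPdist_lt => e e0.
have d0 : 0 < (e / (C + 1)) `^ alpha^-1 by rewrite powR_gt0// divr_gt0.
near=> y.
have sym : `|f x - f y| <= C * `|x - y| `^ alpha.
  have yab : y \in `[a, b] by near: y; exact: withinT.
  move: xab yab; rewrite !in_itv/= => /andP[ax xb] /andP[ay yb].
  have [xy|/ltW yx] := leP x y.
    rewrite distrC [`|x - y|]distrC (ger0_norm (_ : 0 <= y - x)) ?subr_ge0//.
    by apply: hC => //; lra.
  by rewrite (ger0_norm (_ : 0 <= x - y)) ?subr_ge0//; apply: hC => //; lra.
apply: (le_lt_trans sym).
have xy : `|x - y| < (e / (C + 1)) `^ alpha^-1.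
  by near: y; apply: cvg_within; apply/nbhs_ballP;
     exists ((e / (C + 1)) `^ alpha^-1) => //= z; rewrite -ball_normE.
have : `|x - y| `^ alpha < e / (C + 1).
  have : `|x - y| `^ alpha < ((e / (C + 1)) `^ alpha^-1) `^ alpha.
    by rewrite gt0_ltr_powR ?nnegrE// ltW.
  by rewrite -powRrM mulVf ?gt_eqF// powRr1// divr_ge0// ltW.
rewrite ltr_pdivlMr// mulrDr mulr1 mulrC => /(le_lt_trans _); apply.
by rewrite lerDl powR_ge0.
Unshelve. all: by end_near. Qed.

Lemma holder_integrable a b : t0 <= a -> b <= t1 ->
  (@lebesgue_measure R).-integrable `[a, b] (EFin \o f).
Proof.
move=> t0a bt1; apply: continuous_compact_integrable; first exact: segment_compact.
exact: holder_continuous.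
Qed.

End Drift.

Section DriftIncrement.
Context {R : realType}.
Variables (alpha t0 t1 : R) (f : R -> R).
Hypothesis alpha_gt0 : 0 < alpha.
Hypothesis hf : bigO t0 t1 alpha (fun s t => f t - f s).
Notation int a b := (\int[@lebesgue_measure R]_(r in `[a, b]) f r).

(** The order [1 + alpha] is at least [3 * alpha] when [alpha <= 1/2], so drifts
    only contribute their first-order term to the expansions below. *)
Lemma drift_estimate : bigO t0 t1 (1 + alpha)
  (fun s t => int s t - (t - s) * f s).
Proof.
have [C C0 hC] := bigO_ge0 hf; exists C => s t t0s st tt1.
pose c := f s; pose g r := `|f r - c|.
have if_ := holder_integrable alpha_gt0 hf t0s tt1.
have hcst (k : R) : bigO t0 t1 alpha (fun _ _ => k - k).
  by apply: eq_bigO (bigO0 _ _ _) => *; rewrite subrr.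
have icst (k : R) := holder_integrable alpha_gt0 (f := fun=> k) (hcst k) t0s tt1.
have hg0 : bigO t0 t1 alpha (fun s t => (f t - c) - (f s - c)).
  by apply: eq_bigO hf => *; ring.
have ig0 := holder_integrable alpha_gt0 (f := fun r => f r - c) hg0 t0s tt1.
have hg : bigO t0 t1 alpha (fun s t => g t - g s).
  by apply: bigO_dominated hg0 => *; exact: ler_dist_dist.
have ig := holder_integrable alpha_gt0 hg t0s tt1.
have mE (k : R) : \int[@lebesgue_measure R]_(r in `[s, t]) k = (t - s) * k.
  rewrite Rintegral_cst//= lebesgue_measure_itv/= lte_fin mulrC.
  by case: ltP => //= ts; rewrite (_ : t - s = 0)//; lra.
have -> : int s t - (t - s) * f s
    = \int[@lebesgue_measure R]_(r in `[s, t]) (f r - c).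
  by rewrite RintegralB// mE.
apply: le_trans (le_normr_Rintegral _ ig0) _ => //.
have := mE (C * (t - s) `^ alpha).
have -> : C * (t - s) `^ (1 + alpha) = (t - s) * (C * (t - s) `^ alpha).
  rewrite (powRD_ge0 _ ler01 (ltW alpha_gt0)) powRr1 ?subr_ge0//.
  by rewrite mulrCA mulrA.
move=> <-; apply: le_Rintegral => // r /=; rewrite in_itv/= => /andP[sr rt].
rewrite /g (le_trans (hC _ _ t0s sr (le_trans rt tt1)))// ler_wpM2l//.
by rewrite ge0_ler_powR ?nnegrE ?subr_ge0 ?lerB// ltW.
Qed.

Lemma integral_split a b c : t0 <= a -> a <= b -> b <= c -> c <= t1 ->
  int a c = int a b + int b c.
Proof.
move=> t0a ab bc ct1.
have iac := holder_integrable alpha_gt0 hf t0a ct1.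
have ibc := holder_integrable alpha_gt0 hf (le_trans t0a ab) ct1.
have := Rintegral_itvB (b := BRight c) iac (_ : (BLeft a <= BRight b)%O)
  (_ : (BRight b <= BRight c)%O).
rewrite !bnd_simp => /(_ ab bc).
rewrite Rintegral_itv_obnd_cbnd; first by move=> <-; ring.
by apply: integrableS ibc => //; apply: subset_itvr; rewrite bnd_simp.
Qed.

Lemma drift_increment_forward : bigO t0 t1 (1 + alpha)
  (fun s t => int t0 t - int t0 s - (t - s) * f s).
Proof.
apply: eq_bigO drift_estimate => s t t0s st tt1.
by rewrite (integral_split (lexx t0) t0s st tt1); ring.
Qed.

Lemma drift_increment_backward : bigO t0 t1 (1 + alpha)
  (fun s t => int s t1 - int t t1 - (t - s) * f s).
Proof.
apply: eq_bigO drift_estimate => s t t0s st tt1.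
by rewrite (integral_split t0s st tt1 (lexx t1)); ring.
Qed.

End DriftIncrement.

(** * Local expansions of rough differential equations *)

Section Expansion.
Context {R : realType} {K : nat}.
Variables (alpha t0 t1 : R) (Z : R -> 'cV[R]_K) (ZZ : R -> R -> 'M[R]_K).
Hypotheses (alpha_gt : 3^-1 < alpha) (alpha_le : alpha <= 2^-1).
Hypothesis t0_lt_t1 : t0 < t1.
Hypothesis hZ : geometric_rough_path alpha t0 t1 Z ZZ.

Let alpha_ge0 : 0 <= alpha.
Proof. by apply: le_trans (ltW alpha_gt); rewrite invr_ge0. Qed.

(** The local form of [dx = b dt + sum_k A_k dZ^k], where [A' j k] collects the
    coefficients of the iterated integrals of [Z^j] against [Z^k].  The
    order [3 alpha] of the remainder is greater than [1], so that remainders do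
    not add up over fine partitions. *)
Record rough_expansion (x b : R -> R) (A : 'I_K -> R -> R)
    (A' : 'I_K -> 'I_K -> R -> R) : Prop := RoughExpansion {
  re_local : bigO t0 t1 (3 * alpha)
    (fun s t => x t - x s - ((t - s) * b s + germ Z ZZ A A' s t)) ;
  re_drift : path_bounded t0 t1 b ;
  re_coef : forall k, path_bounded t0 t1 (A k) ;
  re_deriv : forall j k, path_bounded t0 t1 (A' j k)
}.

Section Consequences.
Variables (x b : R -> R) (A : 'I_K -> R -> R) (A' : 'I_K -> 'I_K -> R -> R).
Hypothesis hx : rough_expansion x b A A'.

(** Drift and second level are of order [1] and [2 alpha], and [2 alpha <= 1]. *)
Lemma rough_expansion_remainder : bigO t0 t1 (2 * alpha)
  (fun s t => x t - x s - \sum_k (Z t - Z s) k 0 * A k s).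
Proof.
have h1 : bigO t0 t1 (2 * alpha)
    (fun s t => x t - x s - ((t - s) * b s + germ Z ZZ A A' s t)).
  by apply: bigO_weaken (re_local hx); [rewrite mulr_ge0|rewrite ler_wpM2r// ler_nat].
have h2 : bigO t0 t1 (2 * alpha) (fun s t => b s * (t - s)).
  apply: (@bigO_weaken _ _ _ _ 1); first by rewrite mulr_ge0.
    by move: alpha_le; lra.
  by apply: bigOMl (re_drift hx) (bigO_id _ _).
have h3 : bigO t0 t1 (2 * alpha) (fun s t => \sum_j \sum_k A' j k s * ZZ s t j k).
  apply: bigO_sum => j; apply: bigO_sum => k.
  by apply: bigOMl (re_deriv hx j k) (bigO_ZZ hZ j k); rewrite mulr_ge0.
apply: eq_bigO (bigOD (bigOD h1 h2) h3) => s t *.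
have -> : \sum_j \sum_k A' j k s * ZZ s t j k = \sum_j \sum_k ZZ s t j k * A' j k s.
  by apply: eq_bigr => j _; apply: eq_bigr => k _; rewrite mulrC.
by rewrite /germ; ring.
Qed.

Lemma rough_expansion_sum_bigO :
  bigO t0 t1 alpha (fun s t => \sum_k (Z t - Z s) k 0 * A k s).
Proof.
apply: (@eq_bigO _ _ _ _ _ (fun s t => \sum_k A k s * (Z t - Z s) k 0)).
  by move=> s t *; apply: eq_bigr => k _; rewrite mulrC.
by apply: bigO_sum => k; apply: bigOMl (re_coef hx k) (bigO_Z hZ k).
Qed.

Lemma rough_expansion_increment : bigO t0 t1 alpha (fun s t => x t - x s).
Proof.
have h : bigO t0 t1 alpha
    (fun s t => x t - x s - \sum_k (Z t - Z s) k 0 * A k s).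
  by apply: bigO_weaken rough_expansion_remainder => //; rewrite ler_peMl// ler1n.
by apply: eq_bigO (bigOD h rough_expansion_sum_bigO) => *; rewrite subrK.
Qed.

Lemma rough_expansion_bounded : path_bounded t0 t1 x.
Proof.
exact: bounded_of_bigO alpha_ge0 (ltW t0_lt_t1) rough_expansion_increment.
Qed.

End Consequences.

End Expansion.

(** * The Leibniz rule for rough expansions *)

Section ExpansionAlgebra.
Context {R : realType} {K : nat}.
Variables (alpha t0 t1 : R) (Z : R -> 'cV[R]_K) (ZZ : R -> R -> 'M[R]_K).
Hypotheses (alpha_gt : 3^-1 < alpha) (alpha_le : alpha <= 2^-1).
Hypothesis t0_lt_t1 : t0 < t1.
Hypothesis hZ : geometric_rough_path alpha t0 t1 Z ZZ.
Notation expands := (rough_expansion alpha t0 t1 Z ZZ).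

Let alpha_ge0 : 0 <= alpha.
Proof. by apply: le_trans (ltW alpha_gt); rewrite invr_ge0. Qed.

Lemma path_boundedN f : path_bounded t0 t1 f -> path_bounded t0 t1 (fun s : R => - f s).
Proof. by move=> [C hC]; exists C => t *; rewrite normrN hC. Qed.

Lemma rough_expansionD x y bx by_ A B A' B' : expands x bx A A' ->
  expands y by_ B B' ->
  expands (fun s => x s + y s) (fun s => bx s + by_ s)
    (fun k s => A k s + B k s) (fun j k s => A' j k s + B' j k s).
Proof.
move=> hx hy; split=> [|| k | j k].
- apply: eq_bigO (bigOD (re_local hx) (re_local hy)) => s t *.
  have -> : germ Z ZZ (fun k s => A k s + B k s) (fun j k s => A' j k s + B' j k s) s t
      = germ Z ZZ A A' s t + germ Z ZZ B B' s t.
    rewrite /germ addrACA; congr (_ + _); rewrite -big_split/=;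
      apply: eq_bigr => k _; first by rewrite mulrDr.
    by rewrite -big_split/=; apply: eq_bigr => j _; rewrite mulrDr.
  by ring.
- exact: path_boundedD (re_drift hx) (re_drift hy).
- exact: path_boundedD (re_coef hx k) (re_coef hy k).
- exact: path_boundedD (re_deriv hx j k) (re_deriv hy j k).
Qed.

Lemma rough_expansionN x b A A' : expands x b A A' ->
  expands (fun s => - x s) (fun s => - b s)
    (fun k s => - A k s) (fun j k s => - A' j k s).
Proof.
move=> hx; split=> [|| k | j k].
- apply: eq_bigO (bigON (re_local hx)) => s t *.
  have -> : germ Z ZZ (fun k s => - A k s) (fun j k s => - A' j k s) s t
      = - germ Z ZZ A A' s t.
    rewrite /germ opprD -!sumrN; congr (_ + _); apply: eq_bigr => k _.
      by rewrite mulrN.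
    by rewrite -sumrN; apply: eq_bigr => j _; rewrite mulrN.
  by ring.
- exact: path_boundedN (re_drift hx).
- exact: path_boundedN (re_coef hx k).
- exact: path_boundedN (re_deriv hx j k).
Qed.

Lemma rough_expansion0 :
  expands (fun=> 0) (fun=> 0) (fun _ _ => 0) (fun _ _ _ => 0).
Proof.
have b0 : path_bounded t0 t1 (fun=> 0) by exists 0 => *; rewrite normr0.
split=> //; apply: eq_bigO (bigO0 _ _ _) => s t *.
rewrite /germ !big1 ?mulr0 ?addr0 ?subrr// => [k _|j _]; last by rewrite mulr0.
by rewrite big1// => j _; rewrite mulr0.
Qed.

Lemma rough_expansion_sum (I : Type) (r : seq I) (x b : I -> R -> R)
    (A : I -> 'I_K -> R -> R) (A' : I -> 'I_K -> 'I_K -> R -> R) :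
  (forall i, expands (x i) (b i) (A i) (A' i)) ->
  expands (fun s => \sum_(i <- r) x i s) (fun s => \sum_(i <- r) b i s)
    (fun k s => \sum_(i <- r) A i k s) (fun j k s => \sum_(i <- r) A' i j k s).
Proof.
move=> h; elim: r => [|i r IH].
  have -> : (fun s => \sum_(i <- [::]) x i s) = (fun=> 0 : R).
    by apply/funext => s; rewrite big_nil.
  have -> : (fun s => \sum_(i <- [::]) b i s) = (fun=> 0 : R).
    by apply/funext => s; rewrite big_nil.
  have -> : (fun k s => \sum_(i <- [::]) A i k s) = (fun _ _ => 0 : R).
    by apply/funext => k; apply/funext => s; rewrite big_nil.
  have -> : (fun j k s => \sum_(i <- [::]) A' i j k s) = (fun _ _ _ => 0 : R).
    by apply/funext => j; apply/funext => k; apply/funext => s; rewrite big_nil.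
  exact: rough_expansion0.
have -> : (fun s => \sum_(l <- i :: r) x l s) =
    (fun s => x i s + \sum_(l <- r) x l s).
  by apply/funext => s; rewrite big_cons.
have -> : (fun s => \sum_(l <- i :: r) b l s) =
    (fun s => b i s + \sum_(l <- r) b l s).
  by apply/funext => s; rewrite big_cons.
have -> : (fun k s => \sum_(l <- i :: r) A l k s) =
    (fun k s => A i k s + \sum_(l <- r) A l k s).
  by apply/funext => k; apply/funext => s; rewrite big_cons.
have -> : (fun j k s => \sum_(l <- i :: r) A' l j k s) =
    (fun j k s => A' i j k s + \sum_(l <- r) A' l j k s).
  by apply/funext => j; apply/funext => k; apply/funext => s; rewrite big_cons.
exact: rough_expansionD.
Qed.

(** Leibniz rule.  The product of the two first-order parts is symmetrised by
    the geometric relation [Z^j Z^k = ZZ^(jk) + ZZ^(kj)], so that it is absorbed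
    by the second level instead of producing a bracket term. *)
Lemma rough_expansionM x y bx by_ A B A' B' : expands x bx A A' ->
  expands y by_ B B' ->
  expands (fun s => x s * y s) (fun s => x s * by_ s + y s * bx s)
    (fun k s => x s * B k s + y s * A k s)
    (fun j k s => x s * B' j k s + y s * A' j k s
                  + (A j s * B k s + A k s * B j s)).
Proof.
move=> hx hy.
have xb := rough_expansion_bounded alpha_gt alpha_le t0_lt_t1 hZ hx.
have yb := rough_expansion_bounded alpha_gt alpha_le t0_lt_t1 hZ hy.
have a2 : 0 <= 2 * alpha by rewrite mulr_ge0.
have a3 : 0 <= 3 * alpha by rewrite mulr_ge0.
split=> [|| k | j k]; last 3 first.
- exact: path_boundedD (path_boundedM xb (re_drift hy))
    (path_boundedM yb (re_drift hx)).
- exact: path_boundedD (path_boundedM xb (re_coef hy k))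
    (path_boundedM yb (re_coef hx k)).
- exact: path_boundedD
    (path_boundedD (path_boundedM xb (re_deriv hy j k))
       (path_boundedM yb (re_deriv hx j k)))
    (path_boundedD (path_boundedM (re_coef hx j) (re_coef hy k))
       (path_boundedM (re_coef hx k) (re_coef hy j))).
have h1 := bigOMl a3 xb (re_local hy).
have h2 := bigOMl a3 yb (re_local hx).
have rx := rough_expansion_remainder alpha_gt alpha_le hZ hx.
have ry := rough_expansion_remainder alpha_gt alpha_le hZ hy.
have dy := rough_expansion_increment alpha_gt alpha_le hZ hy.
have sx := rough_expansion_sum_bigO alpha_gt hZ hx.
have h3 := bigOM a2 alpha_ge0 rx dy; have h4 := bigOM alpha_ge0 a2 sx ry.
(* With [P], [Q] the first-order parts of the increments of [x], [y],
   [dx dy - P Q = (dx - P) dy + P (dy - Q)]. *)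
have e3 : 2 * alpha + alpha = 3 * alpha by ring.
have e4 : alpha + 2 * alpha = 3 * alpha by ring.
rewrite e3 in h3; rewrite e4 in h4.
apply: eq_bigO (bigOD (bigOD h1 h2) (bigOD h3 h4)) => s t t0s st tt1.
set P := \sum_k (Z t - Z s) k 0 * A k s.
set Q := \sum_k (Z t - Z s) k 0 * B k s.
have geo j k : (Z t - Z s) j 0 * (Z t - Z s) k 0 = ZZ s t j k + ZZ s t k j.
  have := congr1 (fun M : 'M[R]_K => M j k) (grp_geometric hZ t0s st tt1).
  by rewrite !mxE big_ord1 !mxE => ->.
have PQ : P * Q = \sum_j \sum_k ZZ s t j k * (A j s * B k s + A k s * B j s).
  rewrite /P /Q mulr_suml.
  transitivity (\sum_j \sum_k ZZ s t j k * (A j s * B k s)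
    + \sum_j \sum_k ZZ s t k j * (A j s * B k s)).
    rewrite -big_split/=; apply: eq_bigr => j _; rewrite mulr_sumr -big_split/=.
    by apply: eq_bigr => k _; rewrite mulrACA geo mulrDl.
  rewrite [X in _ + X]exchange_big/= -big_split/=; apply: eq_bigr => j _.
  by rewrite -big_split/=; apply: eq_bigr => k _; rewrite -mulrDr.
have -> : germ Z ZZ (fun k s => x s * B k s + y s * A k s)
      (fun j k s => x s * B' j k s + y s * A' j k s
                    + (A j s * B k s + A k s * B j s)) s t
    = x s * germ Z ZZ B B' s t + y s * germ Z ZZ A A' s t + P * Q.
  have level1 : \sum_k (Z t - Z s) k 0 * (x s * B k s + y s * A k s)
      = x s * Q + y s * P.
    rewrite /P /Q !mulr_sumr -big_split/=; apply: eq_bigr => k _; ring.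
  have level2 : \sum_j \sum_k ZZ s t j k *
        (x s * B' j k s + y s * A' j k s + (A j s * B k s + A k s * B j s))
      = x s * (\sum_j \sum_k ZZ s t j k * B' j k s)
        + y s * (\sum_j \sum_k ZZ s t j k * A' j k s) + P * Q.
    rewrite PQ !mulr_sumr -big_split -big_split/=; apply: eq_bigr => j _.
    rewrite !mulr_sumr -big_split -big_split/=; apply: eq_bigr => k _; ring.
  by rewrite /germ level1 level2 -/P -/Q; ring.
by ring.
Qed.

End ExpansionAlgebra.

(** * Symplectic invariance of the linearised Hamiltonian fields *)

Section HamiltonianIdentity.
Context {R : realType} {N : nat}.
Implicit Types (f : cotangent R N -> R) (x u v : cotangent R N).

Lemma bilinear_transpose (M M' : 'I_N -> 'I_N -> R) (u v : 'I_N -> R) :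
  (forall i j, M i j = M' j i) ->
  \sum_i u i * \sum_j M i j * v j = \sum_i v i * \sum_j M' i j * u j.
Proof.
move=> MM'; under eq_bigr do rewrite mulr_sumr.
rewrite exchange_big/=; apply: eq_bigr => i _; rewrite mulr_sumr.
by apply: eq_bigr => j _; rewrite MM'; ring.
Qed.

Lemma var_qE f x u i : var_q f (x, u) i 0 =
  \sum_j hess basis_p basis_q f x i j * u.1 j 0
  + \sum_j hess basis_p basis_p f x i j * u.2 j 0.
Proof. by rewrite /var_q/= !mxE. Qed.

Lemma var_pE f x u i : var_p f (x, u) i 0 =
  \sum_j hess basis_q basis_p f x i j * u.2 j 0
  + \sum_j hess basis_q basis_q f x i j * u.1 j 0.
Proof. by rewrite /var_p/= !mxE. Qed.

Lemma hess_sym (e e' : 'I_N -> cotangent R N) f x i j : smooth f ->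
  hess e e' f x i j = hess e' e f x j i.
Proof.
move=> sf; rewrite [LHS]mxE [RHS]mxE.
exact: (schwarz (e i) (e' j) x (sf 2%N)).
Qed.

(** A block matrix with symmetric diagonal blocks and mutually transposed
    off-diagonal ones is Hamiltonian, hence infinitesimally symplectic. *)
Lemma hamiltonian_form_eq0 (a b c d : 'I_N -> 'I_N -> R) (u1 u2 v1 v2 : 'I_N -> R) :
  (forall i j, c i j = a j i) -> (forall i j, b i j = b j i) ->
  (forall i j, d i j = d j i) ->
  \sum_i ((u2 i * (\sum_j c i j * v1 j + \sum_j d i j * v2 j)
            + v1 i * - (\sum_j a i j * u2 j + \sum_j b i j * u1 j))
         - (v2 i * (\sum_j c i j * u1 j + \sum_j d i j * u2 j)
            + u1 i * - (\sum_j a i j * v2 j + \sum_j b i j * v1 j))) = 0.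
Proof.
move=> ca bb dd.
under eq_bigr do rewrite !mulrN !mulrDr !opprD !opprK.
rewrite !big_split/= !sumrN.
rewrite (bilinear_transpose u2 v1 ca) (bilinear_transpose u2 v2 dd).
rewrite (bilinear_transpose v2 u1 ca) (bilinear_transpose v1 u1 bb).
by ring.
Qed.

(** The variation of [omega] along the linearised Hamiltonian field of [f]: it
    vanishes because the Hessian of [f] is symmetric. *)
Lemma variational_form_eq0 f x u v : smooth f ->
  \sum_i ((u.2 i 0 * var_q f (x, v) i 0 + v.1 i 0 * - var_p f (x, u) i 0)
        - (v.2 i 0 * var_q f (x, u) i 0 + u.1 i 0 * - var_p f (x, v) i 0)) = 0.
Proof.
move=> sf; rewrite -[RHS](hamiltonian_form_eq0
  (fun i => u.1 i 0) (fun i => u.2 i 0) (fun i => v.1 i 0) (fun i => v.2 i 0)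
  (fun i j => @hess_sym basis_p basis_q f x i j sf)
  (fun i j => @hess_sym basis_q basis_q f x i j sf)
  (fun i j => @hess_sym basis_p basis_p f x i j sf)).
apply: eq_bigr => i _.
by rewrite (var_qE f x v i) (var_pE f x u i) (var_qE f x u i) (var_pE f x v i).
Qed.

Lemma linear_coord_q i : linear (fun u : cotangent R N => u.1 i 0).
Proof. by move=> a u v /=; rewrite !mxE. Qed.

Lemma linear_coord_p i : linear (fun u : cotangent R N => u.2 i 0).
Proof. by move=> a u v /=; rewrite !mxE. Qed.

Lemma continuous_coord_q i : continuous (fun u : cotangent R N => u.1 i 0).
Proof.
move=> u; apply: (@continuous_comp _ _ _ fst (fun M : 'cV[R]_N => M i 0)).
  exact: cvg_fst.
exact: coord_continuous.
Qed.

Lemma continuous_coord_p i : continuous (fun u : cotangent R N => u.2 i 0).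
Proof.
move=> u; apply: (@continuous_comp _ _ _ snd (fun M : 'cV[R]_N => M i 0)).
  exact: cvg_snd.
exact: coord_continuous.
Qed.

Lemma omegaE x u v :
  omega x u v = \sum_i (u.2 i 0 * v.1 i 0 - v.2 i 0 * u.1 i 0).
Proof.
apply: eq_bigr => i _; rewrite /wedge /d1.
have [_ dp] := linear_differential (linear_coord_p i) (@continuous_coord_p i) x.
have [_ dq] := linear_differential (linear_coord_q i) (@continuous_coord_q i) x.
have mulE (a a' b b' c c' d d' : R) : a = a' -> b = b' -> c = c' -> d = d' ->
  a * b - c * d = a' * b' - c' * d' by move=> -> -> -> ->.
exact: mulE (dp u) (dq v) (dp v) (dq u).
Qed.

Notation tangent := (cotangent R N * cotangent R N)%type.

Lemma C11_tangent_q i : C11 (fun y : tangent => y.2.1 i 0).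
Proof.
apply: C11_linear => [a u v|u]; first by rewrite /= !mxE.
apply: (@continuous_comp _ _ _ snd (fun w : cotangent R N => w.1 i 0)).
  exact: cvg_snd.
exact: continuous_coord_q.
Qed.

Lemma C11_tangent_p i : C11 (fun y : tangent => y.2.2 i 0).
Proof.
apply: C11_linear => [a u v|u]; first by rewrite /= !mxE.
apply: (@continuous_comp _ _ _ snd (fun w : cotangent R N => w.2 i 0)).
  exact: cvg_snd.
exact: continuous_coord_p.
Qed.

Lemma C11_hess (e e' : 'I_N -> cotangent R N) f i j : smooth f ->
  C11 (fun y : tangent => hess e e' f y.1 i j).
Proof.
move=> sf.
have -> : (fun y : tangent => hess e e' f y.1 i j)
    = (fun y : tangent => 'D_(e i) ('D_(e' j) f) y.1).
  by apply/funext => y; rewrite mxE.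
apply: (@C11_fst _ _ _ (fun x => 'D_(e i) ('D_(e' j) f) x)).
exact: smooth_C11 (smooth_derive (e i) (smooth_derive (e' j) sf)).
Qed.

Lemma C11_var_q f i : smooth f -> C11 (fun y : tangent => var_q f y i 0).
Proof.
move=> sf.
have -> : (fun y : tangent => var_q f y i 0) = (fun y : tangent =>
    \sum_j hess basis_p basis_q f y.1 i j * y.2.1 j 0
    + \sum_j hess basis_p basis_p f y.1 i j * y.2.2 j 0).
  by apply/funext => -[x u]; rewrite var_qE.
apply: C11D; apply: C11_sum => j; apply: C11M.
- exact: C11_hess.
- exact: C11_tangent_q.
- exact: C11_hess.
- exact: C11_tangent_p.
Qed.

Lemma C11_var_p f i : smooth f -> C11 (fun y : tangent => var_p f y i 0).
Proof.
move=> sf.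
have -> : (fun y : tangent => var_p f y i 0) = (fun y : tangent =>
    \sum_j hess basis_q basis_p f y.1 i j * y.2.2 j 0
    + \sum_j hess basis_q basis_q f y.1 i j * y.2.1 j 0).
  by apply/funext => -[x u]; rewrite var_pE.
apply: C11D; apply: C11_sum => j; apply: C11M.
- exact: C11_hess.
- exact: C11_tangent_p.
- exact: C11_hess.
- exact: C11_tangent_q.
Qed.

Lemma is_derive_line0 (V : normedModType R) (F : V -> R) (y w : V) : C11 F ->
  is_derive (0 : R) 1 (fun h : R => F (y + h *: w)) ('D_w F y).
Proof.
move=> [dF _]; have := is_derive_line (x := y) (v := w) (h := 0) (dF _).
by rewrite scale0r addr0.
Qed.

Lemma is_derive_affine (a b : R) : is_derive (0 : R) 1 (fun h : R => a + h * b) b.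
Proof.
have did : differentiable (id : R -> R) (a + 0 *: b) by [].
have := is_derive_line did.
by rewrite derive_id.
Qed.

(** The coefficient of the iterated integral of [Z^j] against [Z^k] in the
    expansion of [omega] is the derivative, along the [j]-th field, of the
    coefficient of [dZ^k].  The latter vanishes at every base point and for all
    tangent vectors, and hence so do its directional derivatives. *)
Lemma variational_form_derivative f x u v x' u' v' : smooth f ->
  \sum_i ((u.2 i 0 * 'D_(x', v') (fun y : tangent => var_q f y i 0) (x, v)
           + v.1 i 0 * - 'D_(x', u') (fun y : tangent => var_p f y i 0) (x, u)
           + (u'.2 i 0 * var_q f (x, v) i 0 + v'.1 i 0 * - var_p f (x, u) i 0))
        - (v.2 i 0 * 'D_(x', u') (fun y : tangent => var_q f y i 0) (x, u)
           + u.1 i 0 * - 'D_(x', v') (fun y : tangent => var_p f y i 0) (x, v)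
           + (v'.2 i 0 * var_q f (x, u) i 0 + u'.1 i 0 * - var_p f (x, v) i 0))) = 0.
Proof.
move=> sf.
pose q i (w w' : cotangent R N) (h : R) := var_q f ((x, w) + h *: (x', w')) i 0.
pose p i (w w' : cotangent R N) (h : R) := var_p f ((x, w) + h *: (x', w')) i 0.
pose l (a a' : R) (h : R) := a + h * a'.
have dq i w w' : is_derive (0 : R) 1 (q i w w')
    ('D_(x', w') (fun y : tangent => var_q f y i 0) (x, w)).
  exact: is_derive_line0 (C11_var_q i sf).
have dp i w w' : is_derive (0 : R) 1 (p i w w')
    ('D_(x', w') (fun y : tangent => var_p f y i 0) (x, w)).
  exact: is_derive_line0 (C11_var_p i sf).
have dl a a' : is_derive (0 : R) 1 (l a a') a' by exact: is_derive_affine.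
pose phi i := (l (u.2 i 0) (u'.2 i 0) * q i v v'
    + l (v.1 i 0) (v'.1 i 0) * (- p i u u'))
  - (l (v.2 i 0) (v'.2 i 0) * q i u u'
    + l (u.1 i 0) (u'.1 i 0) * (- p i v v')).
(* [phi i] is the [i]-th summand of the identity along the line through
   [(x, u, v)] in the direction [(x', u', v')]. *)
have phi0 : \sum_i phi i = cst 0.
  apply/funext => h; rewrite fct_sumE.
  rewrite -[RHS](variational_form_eq0 (x + h *: x') (u + h *: u') (v + h *: v') sf).
  apply: eq_bigr => i _.
  have c1 (w w' : cotangent R N) : (w + h *: w').1 i 0 = l (w.1 i 0) (w'.1 i 0) h.
    by rewrite /= !mxE.
  have c2 (w w' : cotangent R N) : (w + h *: w').2 i 0 = l (w.2 i 0) (w'.2 i 0) h.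
    by rewrite /= !mxE.
  by rewrite (c1 u u') (c2 u u') (c1 v v') (c2 v v').
have dprod a a' (G : R -> R) dG : is_derive (0 : R) 1 G dG ->
    is_derive (0 : R) 1 (l a a' * G) (a * dG + a' * G 0).
  move=> hG; apply: (is_derive_eq (is_deriveM (dl a a') hG)).
  by rewrite /l mul0r addr0; congr (_ + _); exact: mulrC.
have dphi i := is_deriveB
  (is_deriveD (dprod (u.2 i 0) (u'.2 i 0) _ _ (dq i v v'))
              (dprod (v.1 i 0) (v'.1 i 0) _ _ (is_deriveN (dp i u u'))))
  (is_deriveD (dprod (v.2 i 0) (v'.2 i 0) _ _ (dq i u u'))
              (dprod (u.1 i 0) (u'.1 i 0) _ _ (is_deriveN (dp i v v')))).
have := derive_cst (0 : R) (0 : R) (1 : R); rewrite -phi0.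
rewrite (@derive_val _ _ _ _ _ _ _ (is_derive_sum dphi)) => e0.
rewrite -[RHS]e0.
apply: eq_bigr => i _.
have q0 w w' : q i w w' 0 = var_q f (x, w) i 0 by rewrite /q scale0r addr0.
have p0 w w' : (- p i w w') 0 = - var_p f (x, w) i 0.
  by rewrite -[LHS]/(- p i w w' 0) /p scale0r addr0.
rewrite (q0 v v') (q0 u u') (p0 u u') (p0 v v').
by congr (_ - _); rewrite [RHS]addrACA.
Qed.

End HamiltonianIdentity.

(** * Local expansion of the rough equations *)

Section RoughEquations.
Context {R : realType} {K d : nat}.
Variables (alpha t0 t1 : R) (Z : R -> 'cV[R]_K) (ZZ : R -> R -> 'M[R]_K).
Hypotheses (alpha_gt : 3^-1 < alpha) (alpha_le : alpha <= 2^-1).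
Hypothesis t0_lt_t1 : t0 < t1.
Hypothesis hZ : geometric_rough_path alpha t0 t1 Z ZZ.

Let alpha_gt0 : 0 < alpha.
Proof. by apply: lt_trans alpha_gt; rewrite invr_gt0. Qed.

Variables (V : normedModType R) (X : R -> V) (X' : 'I_K -> R -> V).
Hypothesis hX : controlled alpha t0 t1 Z X X'.
Variables (F0 : V -> 'cV[R]_d) (F : 'I_K -> V -> 'cV[R]_d).
Hypothesis hF0 : forall i, C11 (fun y => F0 y i 0).
Hypothesis hF : forall k i, C11 (fun y => F k y i 0).
Variable x : R -> 'cV[R]_d.

Lemma C11_holder (G : V -> R) : C11 G ->
  bigO t0 t1 alpha (fun s t => G (X t) - G (X s)).
Proof.
move=> hG; have [M hM] := controlled_bounded alpha_gt t0_lt_t1 hZ hX.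
have [C C0 hC] := C11_lipschitz hG M.
have [c hc] := controlled_increment alpha_gt t0_lt_t1 hZ hX.
exists (C * c) => s t t0s st tt1; rewrite -mulrA.
apply: (le_trans (hC _ _ (hM _ t0s (le_trans st tt1)) (hM _ (le_trans t0s st) tt1))).
by rewrite ler_wpM2l// -normr_id hc.
Qed.

Lemma C11_path_bounded (G : V -> R) : C11 G ->
  path_bounded t0 t1 (fun s => G (X s)).
Proof.
by move=> hG; apply: (bounded_of_bigO (ltW alpha_gt0) (ltW t0_lt_t1) (C11_holder hG)).
Qed.

Lemma derive_coord k i y v :
  ('D_v (F k) y) i 0 = 'D_v (fun z => F k z i 0) y.
Proof.
rewrite derive_mx ?mxE//; apply/derivable_mxP => j l; rewrite (ord1 l).
exact/diff_derivable/(hF k j).1.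
Qed.

Let coef i k s : R := F k (X s) i 0.
Let coef' i j k s : R := 'D_(X' j s) (fun y => F k y i 0) (X s).

Lemma coef_controlled i k :
  scalar_controlled alpha t0 t1 Z (coef i k) (fun j => coef' i j k).
Proof. exact: (C11_controlled alpha_gt t0_lt_t1 hZ hX (hF k i)). Qed.

Lemma rough_integral_comp_coord a b I i :
  is_rough_integral_comp Z ZZ F X X' a b I ->
  mesh_limit (germ Z ZZ (coef i) (coef' i)) a b (I i 0).
Proof.
move=> /rough_integral_coord => /(_ i).
have -> : (fun j k s => ('D_(X' j s) (F k) (X s)) i 0) = coef' i => [|//].
apply/funext => j; apply/funext => k; apply/funext => s; exact: derive_coord.
Qed.

Lemma drift_order : 3 * alpha <= 1 + alpha.
Proof. by move: alpha_le; lra. Qed.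

Lemma forward_equation_expansion i :
  (forall t, t \in `[t0, t1] -> exists2 I : 'cV[R]_d,
     is_rough_integral_comp Z ZZ F X X' t0 t I &
     x t - x t0 = col_integral (fun r => F0 (X r)) t0 t + I) ->
  rough_expansion alpha t0 t1 Z ZZ (fun s => x s i 0)
    (fun s => F0 (X s) i 0) (coef i) (coef' i).
Proof.
move=> eqx.
pose int t := \int[@lebesgue_measure R]_(r in `[t0, t]) F0 (X r) i 0.
pose I t := x t i 0 - x t0 i 0 - int t.
have hI t : t0 <= t -> t <= t1 ->
    mesh_limit (germ Z ZZ (coef i) (coef' i)) t0 t (I t).
  move=> t0t tt1; have [|J hJ eJ] := eqx t; first by rewrite in_itv/= t0t.
  have -> : I t = J i 0; last exact: rough_integral_comp_coord.
  have := congr1 (fun M : 'cV[R]_d => M i 0) eJ; rewrite !mxE /I /int => ->.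
  by rewrite addrAC subrr add0r.
split=> [|| k | j k].
- have h1 := rough_increment_forward alpha_gt hZ (coef_controlled i) hI.
  have h2 := bigO_weaken (mulr_ge0 (ler0n _ 3) (ltW alpha_gt0)) drift_order
    (drift_increment_forward alpha_gt0 (C11_holder (hF0 i))).
  by apply: eq_bigO (bigOD h1 h2) => s t *; rewrite /I /int; ring.
- exact: C11_path_bounded (hF0 i).
- exact: C11_path_bounded (hF k i).
- exact: bounded_of_bigO (ltW alpha_gt0) (ltW t0_lt_t1)
    (sc_deriv (coef_controlled i k) j).
Qed.

(** An equation posed from [t] to the terminal time determines the increment over
    [s, t] as a difference of two integrals with the same upper end. *)
Lemma backward_equation_expansion i :
  (forall t, t \in `[t0, t1] -> exists2 I : 'cV[R]_d,
     is_rough_integral_comp Z ZZ F X X' t t1 I &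
     x t1 - x t = - (col_integral (fun r => F0 (X r)) t t1 + I)) ->
  rough_expansion alpha t0 t1 Z ZZ (fun s => x s i 0)
    (fun s => - F0 (X s) i 0) (fun k s => - coef i k s)
    (fun j k s => - coef' i j k s).
Proof.
move=> eqx.
pose int t := \int[@lebesgue_measure R]_(r in `[t, t1]) F0 (X r) i 0.
pose I t := x t i 0 - x t1 i 0 - int t.
have hI t : t0 <= t -> t <= t1 ->
    mesh_limit (germ Z ZZ (coef i) (coef' i)) t t1 (I t).
  move=> t0t tt1; have [|J hJ eJ] := eqx t; first by rewrite in_itv/= t0t.
  have -> : I t = J i 0; last exact: rough_integral_comp_coord.
  have := congr1 (fun M : 'cV[R]_d => M i 0) eJ; rewrite !mxE => e.
  have e' : x t i 0 - x t1 i 0 = int t + J i 0 by rewrite -[LHS]opprB e opprK.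
  by rewrite /I e' addrAC subrr add0r.
have -> : (fun s => x s i 0) = (fun s => - - x s i 0).
  by apply/funext => s; rewrite opprK.
apply: rough_expansionN; split=> [|| k | j k].
- have h1 := rough_increment_backward alpha_gt hZ (coef_controlled i) hI.
  have h2 := bigO_weaken (mulr_ge0 (ler0n _ 3) (ltW alpha_gt0)) drift_order
    (drift_increment_backward alpha_gt0 (C11_holder (hF0 i))).
  by apply: eq_bigO (bigOD h1 h2) => s t *; rewrite /I /int; ring.
- exact: C11_path_bounded (hF0 i).
- exact: C11_path_bounded (hF k i).
- exact: bounded_of_bigO (ltW alpha_gt0) (ltW t0_lt_t1)
    (sc_deriv (coef_controlled i k) j).
Qed.

End RoughEquations.

(** * Conservation of the symplectic form *)

(** Once all coefficients vanish, the increments are of order [3 alpha > 1]. *)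
Lemma rough_expansion_constant (R : realType) (K : nat) (alpha t0 t1 : R)
    (Z : R -> 'cV[R]_K) (ZZ : R -> R -> 'M[R]_K) x b A A' :
  3^-1 < alpha -> rough_expansion alpha t0 t1 Z ZZ x b A A' ->
  (forall s, b s = 0) -> (forall k s, A k s = 0) -> (forall j k s, A' j k s = 0) ->
  forall s t, t0 <= s -> s <= t -> t <= t1 -> x t = x s.
Proof.
move=> alpha_gt hx b0 A0 A'0; apply: (@bigO_gt1_constant _ _ _ (3 * alpha)).
  by lra.
apply: eq_bigO (re_local hx) => s t *.
rewrite b0 /germ !big1 ?mulr0 ?addr0 ?subr0// => [j _|k _].
  by rewrite big1// => k _; rewrite A'0 mulr0.
by rewrite A0 mulr0.
Qed.

Theorem proposition2p4 (R : realType) (N K : nat) (alpha t0 t1 : R)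
    (Z : R -> 'cV[R]_K) (ZZ : R -> R -> 'M[R]_K)
    (H : cotangent R N -> R) (HH : cotangent R N -> 'cV[R]_K)
    (a b da1 db1 da2 db2 : 'cV[R]_N) (gamma xi1 xi2 : R -> cotangent R N)
    (alpha_gt : 3^-1 < alpha) (alpha_le : alpha <= 2^-1) (t0_lt_t1 : t0 < t1)
    (hZ : geometric_rough_path alpha t0 t1 Z ZZ)
    (hH : smooth H) (hHH : smooth HH)
    (hgamma : rough_hamilton_solution alpha t0 t1 Z ZZ H HH a b gamma)
    (hxi1 : rough_variational_solution alpha t0 t1 Z ZZ H HH gamma da1 db1 xi1)
    (hxi2 : rough_variational_solution alpha t0 t1 Z ZZ H HH gamma da2 db2 xi2) :
  forall s t : R, s \in `[t0, t1] -> t \in `[t0, t1] ->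
    omega (gamma t) (xi1 t) (xi2 t) = omega (gamma s) (xi1 s) (xi2 s).
Proof.
have sHH k : smooth (comp_HH HH k) by exact: smooth_coord.
have expansion_q da db xi i :
    rough_variational_solution alpha t0 t1 Z ZZ H HH gamma da db xi ->
    rough_expansion alpha t0 t1 Z ZZ (fun s => (xi s).1 i 0) _ _ _ := fun hxi =>
  forward_equation_expansion alpha_gt alpha_le t0_lt_t1 hZ
    (controlled_pair (rhs_controlled hgamma) (rvs_controlled hxi))
    (fun i => C11_var_q i hH) (fun k i => C11_var_q i (sHH k))
    (x := fun s => (xi s).1) i (rvs_q hxi).
have expansion_p da db xi i :
    rough_variational_solution alpha t0 t1 Z ZZ H HH gamma da db xi ->
    rough_expansion alpha t0 t1 Z ZZ (fun s => (xi s).2 i 0) _ _ _ := fun hxi =>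
  backward_equation_expansion alpha_gt alpha_le t0_lt_t1 hZ
    (controlled_pair (rhs_controlled hgamma) (rvs_controlled hxi))
    (fun i => C11_var_p i hH) (fun k i => C11_var_p i (sHH k))
    (x := fun s => (xi s).2) i (rvs_p hxi).
have product da db xi da' db' xi' i hxi hxi' :=
  rough_expansionM alpha_gt alpha_le t0_lt_t1 hZ
    (expansion_p da db xi i hxi) (expansion_q da' db' xi' i hxi').
have total := rough_expansion_sum (index_enum 'I_N) (fun i =>
  rough_expansionD (product _ _ _ _ _ _ i hxi1 hxi2)
    (rough_expansionN (product _ _ _ _ _ _ i hxi2 hxi1))).
have form_zero f r : smooth f -> \sum_i
    ((xi1 r).2 i 0 * var_q f (gamma r, xi2 r) i 0
       + (xi2 r).1 i 0 * - var_p f (gamma r, xi1 r) i 0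
     + - ((xi2 r).2 i 0 * var_q f (gamma r, xi1 r) i 0
       + (xi1 r).1 i 0 * - var_p f (gamma r, xi2 r) i 0)) = 0.
  exact: variational_form_eq0.
have omega_monotone s t : t0 <= s -> s <= t -> t <= t1 ->
    omega (gamma t) (xi1 t) (xi2 t) = omega (gamma s) (xi1 s) (xi2 s).
  rewrite !omegaE.
  apply: (rough_expansion_constant alpha_gt total).
  - by move=> r; exact: form_zero.
  - by move=> k r; exact: form_zero.
  move=> j k r.
  rewrite -[RHS](variational_form_derivative (gamma r) (xi1 r) (xi2 r)
    (hamilton_deriv HH gamma j r) (variational_deriv HH gamma xi1 j r)
    (variational_deriv HH gamma xi2 j r) (sHH k)).
  apply: eq_bigr => i _.
  have dp xi : (variational_deriv HH gamma xi j r).2 i 0 =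
      - var_p (comp_HH HH j) (gamma r, xi r) i 0 by rewrite mxE.
  rewrite (dp xi1) (dp xi2).
  have alg (x y a1 b1 c1 d1 a2 b2 c2 d2 : R) :
      x + (a1 * b1 + c1 * d1) + - (y + (a2 * b2 + c2 * d2))
      = x + (a1 * b1 + d1 * c1) - (y + (a2 * b2 + d2 * c2)) by ring.
  exact: alg.
move=> s t; rewrite !in_itv/= => /andP[t0s st1] /andP[t0t tt1].
have [st|/ltW ts] := leP s t; first exact: omega_monotone.
by apply/esym; exact: omega_monotone.
Qed.
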